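(* Let $X=(x_{ij})_{1\le i\le n,\,1\le j\le N}$ have i.i.d. entries with $x_{11}\overset{d}{=}-x_{11}$, subgaussian of finite norm, i.e., $\mathbb{E}[x_{11}^{2k}]\le(Ck)^k$ for all $k\in\mathbb{N}$ and some $C>0$, and $\mathbb{E}[x_{11}^2]=1$. Let $A=\frac1NXX^T$, and suppose $\lim_{n\to\infty}\frac nN=\gamma\in(0,\infty)$. Then for $p\in\mathbb{N}$, $p=o(n^{1/2})$, and $\gamma_n=\frac nN$, $$\mathbb{E}[\mathrm{tr}(A^p)]=n\,\beta(p,\gamma_n)\cdot\Big(1+O\Big(\frac{p^2}{n}\Big)\Big).$$
   Context: Here $N=N(n)$ and $p=p(n)$, asymptotics are as $n\to\infty$, and for $k\in\mathbb{N}$, $\gamma>0$, $$\beta(k,\gamma)=\int_{a(\gamma)}^{b(\gamma)}x^kf_\gamma(x)\,dx=\sum_{0\le r\le k-1}\frac{1}{r+1}\binom kr\binom{k-1}{r}\gamma^r,$$ with $a(\gamma)=(1-\sqrt\gamma)^2$, $b(\gamma)=(1+\sqrt\gamma)^2$ and $f_\gamma(x)=\frac{\sqrt{(b(\gamma)-x)(x-a(\gamma))}}{2\pi\gamma x}$ on $[a(\gamma),b(\gamma)]$. *)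

(* Defs.v *)
(* MathComp / MathComp-Analysis *)
From HB Require Import structures.
From mathcomp Require Import all_boot all_order all_algebra.
From mathcomp Require Import all_classical all_reals all_analysis.

Set Implicit Arguments.
Unset Strict Implicit.
Unset Printing Implicit Defensive.

Import Order.TTheory GRing.Theory Num.Theory.
Import numFieldNormedType.Exports.

Local Open Scope classical_set_scope.
Local Open Scope ring_scope.

Definition mp_left (R : realType) (gamma : R) : R := (1 - Num.sqrt gamma) ^+ 2.

Definition mp_right (R : realType) (gamma : R) : R := (1 + Num.sqrt gamma) ^+ 2.

(* Marchenko-Pastur density on [mp_left gamma, mp_right gamma].  For gamma = 1
   the left endpoint is 0, where the totalised division gives the value 0. *)
Definition mp_density (R : realType) (gamma x : R) : R :=
  Num.sqrt ((mp_right gamma - x) * (x - mp_left gamma)) / (2 * pi * gamma * x).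

Definition mp_moment (R : realType) (k : nat) (gamma : R) : R :=
  \int[lebesgue_measure]_(x in `[mp_left gamma, mp_right gamma])
    (x ^+ k * mp_density gamma x).

(* Equality in law of two real random variables.  They are taken as bare
   functions so that this applies to X and \- X. *)
Definition same_distribution (d : measure_display) (T : measurableType d)
    (R : realType) (P : probability T R) (X Y : T -> R) : Prop :=
  forall B : set R, measurable B -> P (X @^-1` B) = P (Y @^-1` B).

(* Mutual independence of a finite family: the product rule for every
   subfamily J and every choice of Borel sets. *)
Definition mutually_independent (d : measure_display) (T : measurableType d)
    (R : realType) (P : probability T R) (I : finType)
    (X : I -> {RV P >-> R}) : Prop :=
  forall (J : {set I}) (B : I -> set R),
    (forall i, i \in J -> measurable (B i)) ->
    P (\bigcap_(i in [set` J]) (X i @^-1` B i)) =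
    (\prod_(i in J) P (X i @^-1` B i))%E.

Definition iid_entries (d : measure_display) (T : measurableType d)
    (R : realType) (P : probability T R) (n N : nat)
    (X : 'I_n -> 'I_N -> {RV P >-> R}) : Prop :=
  mutually_independent (fun ij : 'I_n * 'I_N => X ij.1 ij.2) /\
  forall i j i' j', same_distribution P (X i j) (X i' j').

Definition random_matrix (d : measure_display) (T : measurableType d)
    (R : realType) (P : probability T R) (n N : nat)
    (X : 'I_n -> 'I_N -> {RV P >-> R}) (w : T) : 'M[R]_(n, N) :=
  \matrix_(i, j) X i j w.

Definition sample_covariance (d : measure_display) (T : measurableType d)
    (R : realType) (P : probability T R) (n N : nat)
    (X : 'I_n -> 'I_N -> {RV P >-> R}) (w : T) : 'M[R]_n :=
  N%:R^-1 *: (random_matrix X w *m (random_matrix X w)^T).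

(* Main.v *)
Require Import Defs.
From HB Require Import structures.
From mathcomp Require Import all_boot all_order all_algebra.
From mathcomp Require Import all_classical all_reals all_analysis.
From mathcomp Require Import measurable_realfun.
From mathcomp Require Import ring lra zify.
From mathcomp Require mpoly.
Import -(notations) mpoly.

Set Implicit Arguments.
Unset Strict Implicit.
Unset Printing Implicit Defensive.

Import Order.TTheory GRing.Theory Num.Theory.
Import numFieldNormedType.Exports.

Local Open Scope ring_scope.

(** Expand the trace of [(X X^T)^p] over the closed walks of length [2p] that
    alternate between rows and columns.  By independence the expectation is
    [G_mu(n, N)], the sum over all walks of the product over the edges [e] of
    [mu (m_e)], where [m_e] counts the passages through [e] and [mu k] is the
    [k]-th moment of an entry.  It has to be compared with
    [P(n, N) = n N^p beta(p, n/N)], which is homogeneous of degree [p + 1].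

    For Gaussian moments [g (2m) = (2m-1)!!], integration by parts gives an
    exact recursion for the expectations of products of traces ([trmomS]).  Its
    main terms are the quadratic recursion of the Marchenko-Pastur moments; the
    other terms are nonnegative.  As long as [p^2 <= n] they are smaller by a
    factor [O(p/N)], and the recursion takes [p] steps, so that
    [P <= G_g <= P (1 + 2p/N)^p] ([trmom_ge], [trmom_le]).  The dangerous term
    is the one in which two traces merge; it is controlled by
    [beta(p+q-1) <= q(q+1)/2 beta(p) beta(q)] ([linrec_merge]), which is where
    [p = O(n^(1/2))] enters.

    General entries are reduced to Gaussian ones by changing the dimensions.
    Grouping the walks by their pattern of coincidences, a shape visiting [a]
    rows and [b] columns occurs [n(n-1)...(n-a+1) N(N-1)...(N-b+1)] times.  Such
    a walk uses at least [a + b - 1] edges ([distinct_le_steps]).  Hence a bound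
    [mu (2m) <= K^(m-1) nu (2m)] on moments gives
    [K^(a+b) W_mu <= K^(p+1) W_nu] for the weights of a shape
    ([walk_weight_compare]): excess multiplicity of edges is paid for by missing
    vertices.  The factor [K^(a+b)] amounts to dividing the dimensions by [K],
    and [K^(p+1)] is absorbed by the homogeneity of [P].

    Subgaussian moments satisfy [mu (2m) <= K^(m-1) g (2m)] for a constant [K],
    because [mu 2 = 1]; thus [G_mu(n, N)] is at most
    [K^(p+1) G_g(n/K + p, N/K + p) <= P(n, N) (1 + O(p/n))^(O(p))]
    ([walk_sum_le]), the shift by [p] turning falling factorials into powers.
    In the other direction [mu (2m) >= 1] by convexity, so that
    [g (2m) <= (2p)^(m-1) mu (2m)] for [m <= p]; applying the comparison with
    the roles exchanged and in dimensions [2pn, 2pN] bounds [P(n, N)] by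
    [G_mu(n, N)] up to the ratio of powers to falling factorials, which is
    [1 + O(p^2/n)] ([walk_sum_ge]). *)

(** * Moments of the Marchenko-Pastur density *)

Section MarchenkoPasturMoments.
Variable R : realType.
Local Notation mu := (@lebesgue_measure R).

Lemma Rintegral_FTC (f F : R -> R) (a b : R) : a < b -> continuous f -> continuous F ->
  (forall x, x \in `]a, b[ -> is_derive x 1 F (f x)) ->
  \int[mu]_(x in `[a, b]%classic) f x = F b - F a.
Proof.
move=> ab cf cF dF.
rewrite /Rintegral (@continuous_FTC2 _ f F) //.
- exact: continuous_subspaceT.
- split.
  + by move=> x /dF[].
  + by apply: cvg_at_right_filter; exact: cF.
  + by apply: cvg_at_left_filter; exact: cF.
- by move=> x /dF h; rewrite derive1E (derive_val (is_derive := h)).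
Qed.

Variable g : R.
Hypothesis g_gt0 : 0 < g.
Let s := Num.sqrt g.
Let s_gt0 : 0 < s. Proof. by rewrite sqrtr_gt0. Qed.
Let gE : g = s ^+ 2. Proof. by rewrite sqr_sqrtr // ltW. Qed.
Let a := mp_left g.
Let b := mp_right g.
Let Q x := (b - x) * (x - a).
Let QE x : Q x = - x ^+ 2 + 2 * (1 + g) * x - (1 - g) ^+ 2.
Proof. by rewrite /Q /a /b /mp_left /mp_right -/s gE; ring. Qed.
Let w k x := x ^+ k * Num.sqrt (Q x).
Let J k := \int[mu]_(x in `[a, b]%classic) w k x.

Let ab : a < b.
Proof. by rewrite /a /b /mp_left /mp_right -/s -subr_gt0; have := s_gt0; nra. Qed.

Let cQ : continuous Q.
Proof.
move=> x; apply: cvgM.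
  by apply: cvgB; [exact: cvg_cst | exact: cvg_id].
by apply: cvgB; [exact: cvg_id | exact: cvg_cst].
Qed.

Let csQ : continuous (fun x => Num.sqrt (Q x)).
Proof. by move=> x; apply: continuous_comp; [exact: cQ | exact: sqrt_continuous]. Qed.

Let cw k : continuous (w k).
Proof. by move=> x; apply: cvgM; [exact: exprn_continuous | exact: csQ]. Qed.

Let icont (f : R -> R) : continuous f -> mu.-integrable `[a, b]%classic (EFin \o f).
Proof.
by move=> cf; apply: continuous_compact_integrable;
  [exact: segment_compact | exact: continuous_subspaceT].
Qed.

Let cZw c k : continuous (fun x => c * w k x).
Proof. by move=> x; apply: cvgM; [exact: cvg_cst | exact: cw]. Qed.

(** The right-hand side minus the left-hand side integrates the derivative of
    [x^k Q(x)^(3/2)], which vanishes at both endpoints. *)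
Let J_lin k : (k.+3)%:R * J k.+1 =
  (2 * k + 3)%:R * (1 + g) * J k - k%:R * (1 - g) ^+ 2 * J k.-1.
Proof.
pose F x := x ^+ k * (Q x * Num.sqrt (Q x)).
pose f x := (2 * k + 3)%:R * (1 + g) * w k x - k%:R * (1 - g) ^+ 2 * w k.-1 x - k.+3%:R * w k.+1 x.
have cF : continuous F.
  by move=> x; apply: cvgM; [exact: exprn_continuous | apply: cvgM; [exact: cQ | exact: csQ]].
have cf : continuous f.
  move=> x; apply: cvgB; [apply: cvgB|]; exact: cZw.
have dF x : x \in `]a, b[ -> is_derive x 1 F (f x).
  rewrite in_itv /= => /andP[ax xb].
  have Qx : 0 < Q x by rewrite /Q mulr_gt0 ?subr_gt0.
  have dX : is_derive x 1 (fun y : R => y ^+ k) (k%:R * x ^+ k.-1).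
    by split; [exact: exprn_derivable | rewrite exp_derive scaler1].
  have dQ : is_derive x 1 Q ((b - x) - (x - a)).
    have d1 := is_deriveB (is_derive_cst b x 1) (is_derive_id x (1 : R)).
    have d2 := is_deriveB (is_derive_id x (1 : R)) (is_derive_cst a x 1).
    apply: is_derive_eq (is_deriveM d1 d2) _.
    by rewrite -[LHS]/((b - x) * (1 - 0) + (x - a) * (0 - 1)); ring.
  have dS : is_derive x 1 (Num.sqrt \o Q) ((2 * Num.sqrt (Q x))^-1 * ((b - x) - (x - a))).
    exact: is_derive1_comp (is_derive1_sqrt Qx) dQ.
  apply: is_derive_eq (is_deriveM dX (is_deriveM dQ dS)) _.
  rewrite -[LHS]/(x ^+ k * (Q x * ((2 * Num.sqrt (Q x))^-1 * ((b - x) - (x - a))) +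
      Num.sqrt (Q x) * ((b - x) - (x - a))) + Q x * Num.sqrt (Q x) * (k%:R * x ^+ k.-1)).
  rewrite /f /w.
  have S0 : Num.sqrt (Q x) != 0 by rewrite gt_eqF // sqrtr_gt0.
  have SE := sqr_sqrtr (ltW Qx).
  have -> : Q x * ((2 * Num.sqrt (Q x))^-1 * ((b - x) - (x - a))) =
      Num.sqrt (Q x) * ((b - x) - (x - a)) / 2.
    by rewrite -{1}SE; field.
  have -> : (b - x) - (x - a) = 2 * (1 + g) - 2 * x.
    by rewrite /a /b /mp_left /mp_right -/s gE; ring.
  rewrite QE; set r := Num.sqrt _; case: (k) => [|j] /=.
    by rewrite !expr0; field.
  by rewrite natrD natrM !exprS -!natr1; field.
have := Rintegral_FTC ab cf cF dF.
have Qa : Q a = 0 by rewrite /Q subrr mulr0.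
have Qb : Q b = 0 by rewrite /Q subrr mul0r.
rewrite /F Qa Qb !mul0r !mulr0 subrr.
rewrite RintegralB //=; last 2 first.
- by apply: icont => x; apply: cvgB; exact: cZw.
- by apply: icont; exact: cZw.
rewrite RintegralB //=; last 2 first.
- by apply: icont; exact: cZw.
- by apply: icont; exact: cZw.
rewrite !RintegralZl //= -/(J _) -/(J _) -/(J _); try by apply: icont; exact: cw.
by move=> h; lra.
Qed.

(** Area of a half disc of radius [2 s], after the substitution
    [x = 1 + g + 2 s sin t]. *)
Let J0 : J 0 = 2 * pi * g.
Proof.
pose F (t : R) := (1 + g) + (2 * s) * sin t.
pose h (t : R) := 4 * g * cos t ^+ 2.
have pi2 : - (pi / 2) < pi / 2 :> R.
  by have := pi_gt0 R; lra.
have Fa : F (- (pi / 2)) = a.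
  by rewrite /F sinN sin_pihalf /a /mp_left -/s gE; ring.
have Fb : F (pi / 2) = b by rewrite /F sin_pihalf /b /mp_right -/s gE; ring.
have dF (t : R) : is_derive t 1 F (2 * s * cos t).
  have := is_deriveD (is_derive_cst (1 + g) t (1 : R)) (is_deriveZ (2 * s) (is_derive_sin t)).
  move=> H; refine (@is_derive_eq R R R F t 1 _ _ H _).
  by rewrite add0r.
have F'E : derive1 F = fun t => 2 * s * cos t.
  by apply/funext => t; rewrite derive1E (derive_val (is_derive := dF t)).
have cF' : continuous (fun t : R => 2 * s * cos t).
  by move=> t; apply: cvgM; [exact: cvg_cst | exact: continuous_cos].
have cF : continuous F.
  move=> t; apply: cvgD; first exact: cvg_cst.
  by apply: cvgM; [exact: cvg_cst | exact: continuous_sin].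
have QF t : Q (F t) = (2 * s * cos t) ^+ 2.
  by rewrite QE /F exprMn cos2sin2 gE; ring.
have ch : continuous h.
  move=> t; apply: cvgM; first exact: cvg_cst.
  by apply: (cvgM (f := cos) (g := cos)); exact: continuous_cos.
have -> : J 0 = \int[mu]_(t in `[- (pi / 2), pi / 2]%classic) h t.
  rewrite /J /Rintegral -Fa -Fb integration_by_substitution_increasing //.
  - congr fine; apply: eq_integral => t; rewrite inE /= in_itv /= => /cos_ge0_pihalf ct.
    congr (_%:E); rewrite -[LHS]/(w 0 (F t) * derive1 F t) F'E /w expr0 mul1r QF.
    rewrite sqrtr_sqr ger0_norm.
      by rewrite /h gE; ring.
    by rewrite !mulr_ge0 // ltW.
  - exact: ltW.
  - move=> x y xI yI xy; rewrite /F ltrD2l ltr_pM2l ?mulr_gt0 //.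
    by rewrite ltr_sin.
  - by move=> x _; rewrite F'E; exact: cF'.
  - rewrite F'E; apply/cvg_ex; exists (2 * s * cos (- (pi / 2))).
    by apply: cvg_at_right_filter; exact: cF'.
  - rewrite F'E; apply/cvg_ex; exists (2 * s * cos (pi / 2)).
    by apply: cvg_at_left_filter; exact: cF'.
  - split.
    + by move=> x _; have [] := dF x.
    + by apply: cvg_at_right_filter; exact: cF.
    + by apply: cvg_at_left_filter; exact: cF.
  - by apply: continuous_subspaceT; exact: cw.
pose H (t : R) := 2 * g * (t + sin t * cos t).
have cH : continuous H.
  move=> t; apply: cvgM; first exact: cvg_cst.
  apply: cvgD; first exact: cvg_id.
  by apply: cvgM; [exact: continuous_sin | exact: continuous_cos].
have dH (t : R) : t \in `](- (pi / 2)), (pi / 2)[ -> is_derive t 1 H (h t).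
  move=> _; have := is_deriveZ (2 * g) (is_deriveD (is_derive_id t (1 : R))
    (is_deriveM (is_derive_sin t) (is_derive_cos t))).
  move=> D; refine (@is_derive_eq R R R H t 1 _ _ D _).
  rewrite -[LHS]/(2 * g * (1 + (sin t * (- sin t) + cos t * cos t))) /h.
  by have := cos2Dsin2 t => e; rewrite -e; ring.
rewrite (Rintegral_FTC pi2 ch cH dH) /H sinN cosN sin_pihalf cos_pihalf.
by field.
Qed.

Let g_neq0 : g != 0. Proof. by rewrite gt_eqF. Qed.
Let pi_neq0 : pi != 0 :> R. Proof. by rewrite gt_eqF // pi_gt0. Qed.

(** The identity of integrands also holds at [x = 0], which belongs to the
    support for [g = 1] only: there [Q] vanishes. *)
Lemma mp_momentE k : mp_moment k.+1 g = J k / (2 * pi * g).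
Proof.
rewrite /mp_moment /J -RintegralZr //; last by apply: icont; exact: cw.
apply: eq_Rintegral => x; rewrite inE /= in_itv /= => /andP[ax xb].
rewrite /mp_density -/a -/b -/(Q x) /w exprS.
have [x0|x0] := eqVneq x 0.
  have a0 : a = 0.
    by apply/eqP; rewrite eq_le -{1}x0 ax /= /a /mp_left sqr_ge0.
  have -> : Q x = 0 by rewrite /Q x0 a0 subrr mulr0.
  by rewrite sqrtr0 !(mul0r, mulr0).
by move: (pi : R) pi_neq0 => c c0; field; rewrite x0 c0 g_neq0.
Qed.

Lemma mp_moment1 : mp_moment 1 g = 1.
Proof.
by rewrite mp_momentE J0 divff // !mulf_neq0 // pnatr_eq0.
Qed.

Lemma mp_moment_lin k : (k.+3)%:R * mp_moment k.+2 g =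
  (2 * k + 3)%:R * (1 + g) * mp_moment k.+1 g -
  k%:R * (1 - g) ^+ 2 * (if k is 0 then 1 else mp_moment k g).
Proof.
rewrite !mp_momentE mulrA J_lin; case: k => [|k]; first by ring.
by rewrite mp_momentE; ring.
Qed.

(** For [g > 1] the Marchenko-Pastur law has an atom at 0, which its density does
    not see: it affects the moment of order 0 only, which is 1 for the law. *)
Definition mp_seq k : R := if k is 0 then 1 else mp_moment k g.

End MarchenkoPasturMoments.

(** * Sequences with the three-term recursion of the Marchenko-Pastur moments *)

Section NarayanaSequence.
Variables (R : rcfType) (g : R) (b : nat -> R).
Hypothesis g_gt0 : 0 < g.
Hypothesis b0 : b 0%N = 1.
Hypothesis b1 : b 1%N = 1.
Hypothesis b_lin : forall k,
  (k.+3)%:R * b k.+2 = (2 * k + 3)%:R * (1 + g) * b k.+1 - k%:R * (1 - g) ^+ 2 * b k.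

(** With [G] the generating function of [b], the claim is [H = 0] for
    [H = 1 - G + (1-g) X G + g X G^2], whereas the linear recursion says that a
    first-order differential expression [F] in [G] vanishes.  Completing the
    square, [4 g X H = S^2 - D] for [S = 1 - (1-g) X - 2 g X G], and [F = 0] is
    [2 D S' = D' S] up to a factor.  So [W = S^2 - D] solves [D W' = D' W] with
    [W(0) = 0], which forces [W = 0].  The series are truncated at degree [m]. *)
Lemma linrec_quadratic q : b q.+1 = (1 - g) * b q + g * \sum_(i < q.+1) b i * b (q - i)%N.
Proof.
pose m := q.+2; pose G : {poly R} := \poly_(i < m.+1) b i.
have Gb i : (i <= m)%N -> G`_i = b i by move=> im; rewrite coef_poly ltnS im.
pose D : {poly R} := 1 - (2 * (1 + g))%:P * 'X + ((1 - g) ^+ 2)%:P * 'X * 'X.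
pose F : {poly R} := 1 + (1 - g)%:P * 'X - G + (1 + g)%:P * ('X * G)
  - 'X * G^`() + (2 * (1 + g))%:P * ('X * ('X * G^`()))
  - ((1 - g) ^+ 2)%:P * ('X * ('X * ('X * G^`()))).
pose H : {poly R} := 1 - G + (1 - g)%:P * ('X * G) + g%:P * ('X * (G * G)).
have coefG' i : (i < m)%N -> G^`()`_i = i.+1%:R * b i.+1.
  by move=> im; rewrite coef_deriv Gb // mulr_natl.
have F0 k : (k <= m)%N -> F`_k = 0.
  move=> km; rewrite /F !(coefD, coefB, coefN, coefCM, coefXM, coef1, coefX).
  case: k km => [|[|[|k]]] km /=.
  - by rewrite Gb // b0; ring.
  - by rewrite !Gb ?coefG' // b0 b1; ring.
  - rewrite !Gb ?coefG' //; try lia.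
    by have := b_lin 0; rewrite b1; lra.
  - rewrite !Gb ?coefG' //; try lia.
    have := b_lin k.+1; rewrite natrD natrM -!natr1 => /eqP.
    by rewrite -subr_eq0 => /eqP h; apply/eqP; rewrite -oppr_eq0 -h; apply/eqP; ring.
(* S F = D (X H)' - D' (X H), an identity valid for every G *)
have eqFH : (1 - (1 - g)%:P * 'X - (2 * g)%:P * 'X * G) * F =
    D * (H + 'X * H^`()) - D^`() * ('X * H).
  rewrite /D /F /H !(derivD, derivN, derivM, derivX, derivC, derivMXaddC).
  rewrite ?(rmorphB, rmorphD, rmorphM, rmorphXn, rmorph_nat, rmorph1) /=.
  by ring.
(* the coefficient of degree k of D (X H)' - D' (X H) is (k+1) H_k plus lower H_i *)
have H0 k : (k <= m)%N -> H`_k = 0.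
  elim/ltn_ind: k => k IH km.
  have : ((1 - (1 - g)%:P * 'X - (2 * g)%:P * 'X * G) * F)`_k = 0.
    by rewrite coefM big1 // => i _; rewrite F0 ?mulr0 // (leq_trans (leq_subr _ _)).
  rewrite eqFH.
  have -> : D * (H + 'X * H^`()) - D^`() * ('X * H) = H + 'X * H^`() +
     'X * ((((1 - g) ^+ 2)%:P * 'X - (2 * (1 + g))%:P) * (H + 'X * H^`()) - D^`() * H).
    by rewrite /D; ring.
  rewrite (coefD (H + _)) (coefD H) !coefXM coef_deriv.
  case: k IH km => [|k] IH km /=; first by rewrite !addr0.
  have low i : (k - i <= k)%N by exact: leq_subr.
  have Hlow i : (i <= k)%N -> H`_i = 0 by move=> ik; apply: IH => //; lia.
  rewrite coefB; set A := (_ - _%:P); have -> : (A * (H + 'X * H^`()))`_k = 0.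
    rewrite coefM big1 // => i _; rewrite [(H + _)`__]coefD coefXM coef_deriv Hlow // add0r.
    case E : (k - i)%N => [|j] /=; first by rewrite mulr0.
    by rewrite -E Hlow // mul0rn mulr0.
  have -> : (D^`() * H)`_k = 0 by rewrite coefM big1 // => i _; rewrite Hlow // mulr0.
  by rewrite subr0 addr0 -mulrS => /eqP; rewrite mulrn_eq0 /= => /eqP.
have := H0 q.+1 (leqnSn _).
rewrite /H !(coefD, coefB, coefN, coefCM, coefXM, coef1) /= !Gb //; last exact: ltnW.
rewrite coefM (eq_bigr (fun i : 'I_q.+1 => b i * b (q - i)%N)) => [h|i _].
  by move: h => /eqP; rewrite sub0r -addrA addrC subr_eq0 => /eqP.
by rewrite !Gb //; have := ltn_ord i; rewrite /m; lia.
Qed.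

Lemma linrec_convolution q : b q.+1 = b q + g * \sum_(k < q) b k.+1 * b (q - k.+1)%N.
Proof.
rewrite linrec_quadratic big_ord_recl b0 subn0 mul1r.
under eq_bigr do rewrite lift0.
by ring.
Qed.

Let s := Num.sqrt g.
Let s_gt0 : 0 < s. Proof. by rewrite sqrtr_gt0. Qed.
Let gE : g = s ^+ 2. Proof. by rewrite sqr_sqrtr // ltW. Qed.

Lemma linrec_gt0 q : 0 < b q.
Proof.
elim/ltn_ind: q => -[|q] IH; first by rewrite b0.
rewrite linrec_convolution ltr_pwDl ?IH // mulr_ge0 ?(ltW g_gt0) //.
apply: sumr_ge0 => k _; apply: mulr_ge0; apply: ltW; apply: IH.
  by rewrite ltnS.
by rewrite ltnS leq_subr.
Qed.

(** Both bounds propagate through the recursion because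
    [(1 - g)^2 = (1 - s)^2 (1 + s)^2]: the lower bound on one ratio bounds the
    subtracted term of the recursion, and the same for the upper bound. *)
Lemma linrec_ratio_bounds k : [/\ k.+1%:R * (1 + s) ^+ 2 * b k.+1 <= k.+3%:R * b k.+2
                    & b k.+2 <= (1 + s) ^+ 2 * b k.+1].
Proof.
elim: k => [|k [IH1 IH2]].
  have := b_lin 0; rewrite b1 gE => h.
  have := sqr_ge0 (1 - s); have := sqr_ge0 s; have := s_gt0.
  by move: h; split; lra.
have lin := b_lin k.+1; have p1 := linrec_gt0 k.+1; have p2 := linrec_gt0 k.+2.
have k0 : 0 <= k%:R :> R by exact: ler0n.
move: lin IH1 IH2; rewrite gE !natrD !natrM -!natr1 => lin IH1 IH2.
have e : (1 - s ^+ 2) ^+ 2 = (1 - s) ^+ 2 * (1 + s) ^+ 2 by ring.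
have sq : 0 <= (1 - s) ^+ 2 by exact: sqr_ge0.
have sb : 0 < s * b k.+2 by exact: mulr_gt0.
split.
  have : (k%:R + 1) * (1 - s ^+ 2) ^+ 2 * b k.+1 <= (1 - s) ^+ 2 * ((k%:R + 1 + 1 + 1) * b k.+2).
    by rewrite e; have := ler_wpM2l sq IH1; lra.
  lra.
have : (k%:R + 1) * ((1 - s) ^+ 2 * b k.+2) <= (k%:R + 1) * (1 - s ^+ 2) ^+ 2 * b k.+1.
  have k1 : 0 <= k%:R + 1 :> R by lra.
  rewrite e; have := ler_wpM2l (mulr_ge0 k1 sq) IH2.
  by congr (_ <= _); ring.
have k4 : 0 < k%:R + 4 :> R by lra.
by move=> h; rewrite -(ler_pM2l k4); lra.
Qed.

Lemma linrec_growth p q : b (p + q).+1 <= (1 + s) ^+ (2 * q) * b p.+1.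
Proof.
elim: q => [|q IH]; first by rewrite addn0 muln0 expr0 mul1r.
rewrite addnS mulnS exprD -mulrA; apply: le_trans (linrec_ratio_bounds _).2 _.
by apply: ler_wpM2l => //; exact: sqr_ge0.
Qed.

(** The product of the lower bounds on the ratios telescopes: [b q] is smaller than
    its exponential growth [(1 + s)^(2q)] by at most a quadratic factor. *)
Lemma linrec_lower q : 2 * (1 + s) ^+ (2 * q) <= (q.+1 * q.+2)%:R * b q.+1.
Proof.
elim: q => [|q IH]; first by rewrite b1 muln0 expr0.
rewrite mulnS exprD mulrCA; apply: le_trans (ler_wpM2l (sqr_ge0 _) IH) _.
have := ler_wpM2l (ler0n R q.+2) (linrec_ratio_bounds q).1.
by rewrite !natrM; congr (_ <= _); ring.
Qed.

(** Splitting off [q] steps costs their exponential growth, which [b q.+1] recovers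
    up to a factor quadratic in [q]. *)
Lemma linrec_merge p q : b (p + q).+1 <= (q.+1 * q.+2)%:R / 2 * (b p.+1 * b q.+1).
Proof.
apply: le_trans (linrec_growth p q) _.
have := ler_wpM2r (ltW (linrec_gt0 p.+1)) (linrec_lower q); lra.
Qed.

End NarayanaSequence.

(** * Trace moments of a Gaussian matrix by integration by parts *)

(** An abstract Gaussian matrix: the entries [x i j] live in a commutative ring with
    partial derivatives [D i j] and an expectation [L] obeying integration by
    parts.  Nothing else about Gaussian variables matters. *)
Section SchwingerDyson.
Variables (R : realFieldType) (A : comNzRingType) (n N : nat).
Variables (x : 'I_n -> 'I_N -> A) (D : 'I_n -> 'I_N -> {additive A -> A}).
Variable (L : {additive A -> R}).
Hypothesis DM : forall i j a b, D i j (a * b) = D i j a * b + a * D i j b.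
Hypothesis Dx : forall i j k l, D i j (x k l) = ((i == k) && (j == l))%:R.
Hypothesis Lx : forall i j a, L (x i j * a) = L (D i j a).
Hypothesis L1 : L 1 = 1.

Let X : 'M[A]_(n, N) := \matrix_(i, j) x i j.
Let M : 'M[A]_n := X *m X^T.
Let Y q : 'M[A]_(N, n) := X^T *m M ^+ q.

Definition powtr q : A := \tr (M ^+ q).
Local Notation m := powtr.

Lemma der_mulmx i j a b c (B : 'M[A]_(a, b)) (C : 'M[A]_(b, c)) :
  map_mx (D i j) (B *m C) = map_mx (D i j) B *m C + B *m map_mx (D i j) C.
Proof.
apply/matrixP => k l; rewrite !mxE raddf_sum -big_split /=.
by apply: eq_bigr => h _; rewrite DM !mxE.
Qed.

Lemma der_X i j : map_mx (D i j) X = delta_mx i j.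
Proof. by apply/matrixP => k l; rewrite !mxE Dx ![_ == k]eq_sym ![_ == l]eq_sym. Qed.

Lemma der_XT i j : map_mx (D i j) X^T = delta_mx j i.
Proof. by rewrite -map_trmx der_X trmx_delta. Qed.

Lemma der_gram i j : map_mx (D i j) M = delta_mx i j *m X^T + X *m delta_mx j i.
Proof. by rewrite der_mulmx der_X der_XT. Qed.

Lemma der_1 i j : D i j 1 = 0.
Proof.
by have := DM i j 1 1; rewrite !mulr1 mul1r => /eqP; rewrite eq_sym -subr_eq0 addrK => /eqP.
Qed.

Lemma der_gram_pow i j q : map_mx (D i j) (M ^+ q) =
  \sum_(k < q) M ^+ k *m map_mx (D i j) M *m M ^+ (q - k.+1).
Proof.
elim: q => [|q IH].
  rewrite big_ord0 expr0; apply/matrixP => k l; rewrite !mxE.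
  by case: (k == l); rewrite ?mulr1n ?mulr0n ?raddf0 ?der_1.
rewrite exprS der_mulmx IH big_ord_recl /= expr0 mul1mx subn1 /=; congr (_ + _).
rewrite mulmx_sumr; apply: eq_bigr => k _.
by rewrite !mulmxA subSS -[M *m _]exprS.
Qed.

Lemma gram_sym : M^T = M.
Proof. by rewrite trmx_mul trmxK. Qed.

Lemma gram_pow_sym q : (M ^+ q)^T = M ^+ q.
Proof.
elim: q => [|q IH]; first by rewrite expr0 tr_scalar_mx.
by rewrite exprS trmx_mul IH gram_sym -[_ *m _]exprSr exprS.
Qed.

Lemma tr_XtMpow q : (Y q)^T = M ^+ q *m X.
Proof. by rewrite trmx_mul trmxK gram_pow_sym. Qed.

Lemma mulmx_delta_entry a b c d (B : 'M[A]_(a, b)) (C : 'M[A]_(c, d)) i j k l :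
  (B *m delta_mx i j *m C) k l = B k i * C j l.
Proof.
rewrite !mxE (bigD1 j) //= big1 ?addr0 => [|h hj].
  rewrite !mxE (bigD1 i) //= big1 ?addr0 => [|h hi]; first by rewrite !mxE !eqxx mulr1.
  by rewrite !mxE (negPf hi) mulr0.
rewrite !mxE big1 ?mul0r // => g _.
by rewrite !mxE (negPf hj) andbF mulr0.
Qed.

Lemma der_powtr i j q : D i j (m q) = (Y q.-1 j i) *+ (2 * q).
Proof.
have -> : D i j (m q) = \tr (map_mx (D i j) (M ^+ q)).
  by rewrite /m /mxtrace raddf_sum; apply: eq_bigr => k _; rewrite mxE.
rewrite der_gram_pow raddf_sum /=.
have tr1 : \tr (map_mx (D i j) M *m M ^+ q.-1) = Y q.-1 j i *+ 2.
  rewrite der_gram mulmxDl mxtraceD mulr2n; congr (_ + _).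
    rewrite -mulmxA -/(Y _) /mxtrace (bigD1 i) //= big1 ?addr0.
      by have := mulmx_delta_entry 1%:M (Y q.-1) i j i i; rewrite mul1mx !mxE !eqxx mul1r.
    move=> k ki; have := mulmx_delta_entry 1%:M (Y q.-1) i j k k.
    by rewrite mul1mx !mxE (negPf ki) mul0r.
  rewrite -mulmxA mxtrace_mulC -mulmxA -tr_XtMpow /mxtrace (bigD1 j) //= big1 ?addr0.
    have := mulmx_delta_entry 1%:M (Y q.-1)^T j i j j.
    by rewrite mul1mx !mxE !eqxx mul1r.
  move=> k ki; have := mulmx_delta_entry 1%:M (Y q.-1)^T j i k k.
  by rewrite mul1mx !mxE (negPf ki) mul0r.
case: q tr1 => [|q] tr1; first by rewrite big_ord0.
rewrite (eq_bigr (fun=> Y q j i *+ 2)) => [|k _].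
  by rewrite sumr_const card_ord -mulrnA.
rewrite -mulmxA mxtrace_mulC -mulmxA -[_ *m M ^+ k]exprD -tr1.
by rewrite subSS subnK // -ltnS.
Qed.

Lemma contract_XtMpow p q : \sum_i \sum_j Y p j i * Y q j i = m (p + q).+1.
Proof.
have -> : m (p + q).+1 = \tr ((Y p)^T *m Y q).
  by rewrite tr_XtMpow mulmxA -(mulmxA (M ^+ p)) -[_ *m M]exprSr -[_ *m M ^+ q]exprD addSn.
by apply: eq_bigr => i _; rewrite mxE; apply: eq_bigr => j _; rewrite [_^T _ _]mxE.
Qed.

(** The derivative hits the factor [X^T], which gives [N] copies of the trace, or one
    of the [p] factors [M]; in the latter case it either reverses a loop, leaving
    one trace, or cuts the loop into two traces. *)
Lemma divergence_XtMpow p : \sum_i \sum_j D i j (Y p j i) =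
  m p *+ (N + p) + \sum_(k < p) m k.+1 * m (p - k.+1).
Proof.
have dY i j : D i j (Y p j i) = (M ^+ p) i i +
    \sum_(k < p) (Y k j i * Y (p - k.+1) j i +
                  (X^T *m M ^+ k *m X) j j * (M ^+ (p - k.+1)) i i).
  have -> : D i j (Y p j i) = (map_mx (D i j) (Y p)) j i by rewrite [RHS]mxE.
  rewrite der_mulmx der_XT [LHS]mxE; congr (_ + _).
    have := mulmx_delta_entry 1%:M (M ^+ p) j i j i.
    by rewrite mul1mx => ->; rewrite mxE eqxx mul1r.
  rewrite der_gram_pow mulmx_sumr summxE; apply: eq_bigr => k _.
  rewrite der_gram mulmxDr mulmxDl mulmxDr [LHS]mxE !mulmxA; congr (_ + _).
    by rewrite -(mulmxA _ X^T) mulmx_delta_entry.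
  by rewrite mulmx_delta_entry.
under eq_bigr do under eq_bigr do rewrite dY.
under eq_bigr do rewrite big_split /= sumr_const card_ord.
rewrite big_split /= sumrMnl mulrnDr -addrA; congr (_ + _).
under eq_bigr do rewrite exchange_big /=.
rewrite exchange_big /=.
under eq_bigr do under eq_bigr do rewrite big_split /=.
under eq_bigr do rewrite big_split /=.
rewrite big_split /=; congr (_ + _).
  rewrite (eq_bigr (fun=> m p)) ?sumr_const ?card_ord // => k _.
  by rewrite contract_XtMpow -addSn subnKC.
apply: eq_bigr => k _.
under eq_bigr do rewrite -mulr_suml.
rewrite -mulr_sumr; congr (_ * _).
by rewrite -/(mxtrace _) mxtrace_mulC mulmxA /m exprS.
Qed.

Lemma powtrS p : m p.+1 = \sum_i \sum_j x i j * Y p j i.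
Proof.
rewrite /m exprS -[_ * _]/(_ *m _) -mulmxA -/(Y p) /mxtrace.
by apply: eq_bigr => i _; rewrite mxE; apply: eq_bigr => j _; rewrite mxE.
Qed.

Definition multitr (s : seq nat) : A := \prod_(q <- s) m q.

Definition omit_nth l (s : seq nat) := take l s ++ drop l.+1 s.

Lemma der_multitr i j s : D i j (multitr s) =
  \sum_(l < size s) Y (nth 0%N s l).-1 j i * multitr (omit_nth l s) *+ (2 * nth 0%N s l).
Proof.
elim: s => [|q s IH]; first by rewrite /multitr big_nil big_ord0 der_1.
rewrite /multitr big_cons DM der_powtr big_ord_recl /=.
congr (_ + _); first by rewrite /multitr /omit_nth /= drop0 mulrnAl.
rewrite -/(multitr s) IH mulr_sumr; apply: eq_bigr => l _.
by rewrite -mulrnAl mulrCA -mulrnAl /multitr /omit_nth /= big_cons.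
Qed.

(** Differentiating another trace merges the two loops into one. *)
Lemma contract_der_multitr p s :
  \sum_i \sum_j Y p j i * D i j (multitr s) =
  \sum_(l < size s) multitr ((p + nth 0%N s l)%N :: omit_nth l s) *+ (2 * nth 0%N s l).
Proof.
under eq_bigr do under eq_bigr do rewrite der_multitr mulr_sumr.
under eq_bigr do rewrite exchange_big /=.
rewrite exchange_big /=; apply: eq_bigr => l _.
case E : (nth 0%N s l) => [|q] /=.
  by rewrite muln0 mulr0n big1 // => i _; rewrite big1 // => j _; rewrite mulr0n mulr0.
rewrite /multitr big_cons addnS -contract_XtMpow mulr_suml -sumrMnl.
apply: eq_bigr => i _; rewrite mulr_suml -sumrMnl.
by apply: eq_bigr => j _; rewrite mulrnAr mulrA.
Qed.

Definition trmom s : R := L (multitr s).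

Lemma trmom_nil : trmom [::] = 1.
Proof. by rewrite /trmom /multitr big_nil. Qed.

Lemma trmom0 s : trmom (0%N :: s) = n%:R * trmom s.
Proof.
by rewrite /trmom /multitr big_cons /m expr0 mxtrace1 [X in L X]mulr_natl raddfMn mulr_natl.
Qed.

(** Loop equation: integrate by parts with respect to the first factor of the first
    trace.  The three groups of terms come from shortening or reversing the loop,
    cutting it, and merging it with another one. *)
Lemma trmomS p s : trmom (p.+1 :: s) =
  (N + p)%:R * trmom (p :: s) + \sum_(k < p) trmom [:: k.+1, p - k.+1 & s]%N
  + \sum_(l < size s) (2 * nth 0 s l)%:R * trmom ((p + nth 0 s l) :: omit_nth l s)%N.
Proof.
rewrite /trmom {1}/multitr big_cons -/(multitr s) powtrS mulr_suml raddf_sum /=.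
under eq_bigr do rewrite mulr_suml raddf_sum /=.
under eq_bigr do under eq_bigr do rewrite -mulrA Lx DM raddfD /=.
under eq_bigr do rewrite big_split /=.
rewrite big_split /=; congr (_ + _).
  have -> : \sum_i \sum_j L (D i j (Y p j i) * multitr s) =
     L ((\sum_i \sum_j D i j (Y p j i)) * multitr s).
    rewrite mulr_suml raddf_sum; apply: eq_bigr => i _.
    by rewrite mulr_suml raddf_sum.
  rewrite divergence_XtMpow mulrDl raddfD /=; congr (_ + _).
    by rewrite [X in L X]mulrnAl raddfMn /multitr big_cons mulr_natl.
  rewrite mulr_suml raddf_sum; apply: eq_bigr => k _.
  by rewrite /multitr !big_cons mulrA.
have -> : \sum_i \sum_j L (Y p j i * D i j (multitr s)) =
     L (\sum_i \sum_j Y p j i * D i j (multitr s)).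
  by rewrite raddf_sum; apply: eq_bigr => i _; rewrite raddf_sum.
rewrite contract_der_multitr raddf_sum; apply: eq_bigr => l _.
by rewrite raddfMn mulr_natl.
Qed.

Section TraceMomentBounds.
Variables (P : nat -> R) (S : nat).
Hypothesis N_gt0 : (0 < N)%N.
Hypothesis P0 : P 0 = n%:R.
Hypothesis P_ge0 : forall q, 0 <= P q.
Hypothesis PS : forall p, P p.+1 = N%:R * P p + \sum_(k < p) P k.+1 * P (p - k.+1)%N.

Let prodP s : R := \prod_(q <- s) P q.

Lemma prodP_ge0 s : 0 <= prodP s.
Proof. by rewrite /prodP; apply: prodr_ge0 => q _. Qed.

Lemma prodP_omit_nth l s : (l < size s)%N ->
  prodP s = P (nth 0%N s l) * prodP (omit_nth l s).
Proof.
move=> ls; rewrite /prodP /omit_nth -{1}(cat_take_drop l s) (drop_nth 0%N ls).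
by rewrite !big_cat /= big_cons mulrCA.
Qed.

Lemma sumn_omit_nth l s : (l < size s)%N ->
  sumn s = (nth 0 s l + sumn (omit_nth l s))%N.
Proof.
move=> ls; rewrite /omit_nth -{1}(cat_take_drop l s) (drop_nth 0%N ls).
by rewrite !sumn_cat /= addnCA.
Qed.

(** The terms of the loop equation that are absent from the recursion of [P] are
    nonnegative. *)
Lemma trmom_ge s : prodP s <= trmom s.
Proof.
have [t] := ubnP (sumn s).
elim: t s => // t IHt; elim=> [|[|p] s IHs]; rewrite ?ltnS => st.
- by rewrite /prodP big_nil trmom_nil.
- rewrite trmom0 /prodP big_cons P0; apply: ler_wpM2l; first exact: ler0n.
  by apply: IHs; rewrite ltnS.
have {}st : (p + sumn s < t)%N by move: st; rewrite /= addSn.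
have T_ge0 s' : (sumn s' < t)%N -> 0 <= trmom s'.
  by move=> h; apply: le_trans (prodP_ge0 s') (IHt _ h).
rewrite trmomS /prodP big_cons PS mulrDl.
apply: ler_wpDr.
  apply: sumr_ge0 => l _; apply: mulr_ge0; first exact: ler0n.
  by apply: T_ge0; rewrite /= -addnA -sumn_omit_nth.
apply: lerD.
  rewrite natrD mulrDl; apply: ler_wpDr.
    by apply: mulr_ge0; [exact: ler0n | exact: T_ge0].
  rewrite -mulrA; apply: ler_wpM2l; first exact: ler0n.
  by have := IHt (p :: s) st; rewrite /prodP big_cons.
rewrite mulr_suml; apply: ler_sum => k _.
have := IHt [:: k.+1, (p - k.+1)%N & s]; rewrite /prodP !big_cons mulrA; apply.
by rewrite /= addnA subnKC.
Qed.

(** The price of merging a loop of length [q] into another one. *)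
Hypothesis P_merge : forall p q, (0 < q <= S)%N -> N%:R * P (p + q)%N <= P p.+1 * P q.

Let c : R := 1 + (2 * S)%:R / N%:R.

(** Each step of the loop equation lowers the total degree by 1 and multiplies the
    bound by [c]: relative to [P], reversing the first loop costs [p/N], and
    merging it with the others costs [2 q/N] for a loop of length [q]. *)
Lemma trmom_le s : (sumn s <= S)%N -> trmom s <= prodP s * c ^+ sumn s.
Proof.
have N0 : 0 < N%:R :> R by rewrite ltr0n.
have c_ge0 : 0 <= c by rewrite addr_ge0 // divr_ge0 ?ler0n.
have [t] := ubnP (sumn s).
elim: t s => // t IHt; elim=> [|[|p] s IHs]; rewrite ?ltnS => st sS.
- by rewrite /prodP big_nil trmom_nil mul1r.
- rewrite trmom0 /prodP big_cons P0 -mulrA; apply: ler_wpM2l; first exact: ler0n.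
  by apply: IHs; rewrite ?ltnS.
have {}st : (p + sumn s < t)%N by move: st; rewrite /= addSn.
have {}sS : (p + sumn s < S)%N by move: sS; rewrite /= addSn.
set d := c ^+ (p + sumn s).
have d_ge0 : 0 <= d by exact: exprn_ge0.
have IH s' : sumn s' = (p + sumn s)%N -> trmom s' <= prodP s' * d.
  by move=> e; rewrite /d -e; apply: IHt; rewrite e // ltnW.
rewrite [sumn _]/= addSn exprS -/d /prodP big_cons -/(prodP s) trmomS.
(* shortening and cutting the loop reproduce the recursion of P *)
have le1 : (N + p)%:R * trmom (p :: s) + \sum_(k < p) trmom [:: k.+1, p - k.+1 & s]%N
    <= (P p.+1 + p%:R * P p) * (prodP s * d).
  rewrite PS addrAC -(mulrDl _ _ (P p)) -natrD mulrDl; apply: lerD.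
    rewrite -mulrA; apply: ler_wpM2l; first exact: ler0n.
    by have := IH (p :: s) erefl; rewrite /prodP big_cons mulrA.
  rewrite mulr_suml; apply: ler_sum => k _.
  have := IH [:: k.+1, (p - k.+1)%N & s]; rewrite /prodP !big_cons !mulrA; apply.
  by rewrite /= addnA subnKC.
have le2 : \sum_(l < size s) (2 * nth 0 s l)%:R * trmom ((p + nth 0 s l) :: omit_nth l s)%N
    <= P p.+1 * (prodP s * d) * ((2 * sumn s)%:R / N%:R).
  have -> : (2 * sumn s)%:R / N%:R = \sum_(l < size s) (2 * nth 0 s l)%:R / N%:R :> R.
    rewrite -mulr_suml -natr_sum -big_distrr /=; congr ((2 * _)%:R / _).
    by rewrite sumnE (big_nth 0%N) big_mkord.
  rewrite mulr_sumr; apply: ler_sum => l _.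
  have [->|q_gt0] := posnP (nth 0%N s l); first by rewrite muln0 !mul0r mulr0.
  rewrite [leRHS]mulrCA; apply: ler_wpM2l; first exact: ler0n.
  apply: le_trans (IH _ _) _; first by rewrite /= -addnA -sumn_omit_nth.
  rewrite {1}/prodP big_cons -/(prodP _) (prodP_omit_nth (ltn_ord l)).
  rewrite ler_pdivlMr //.
  have := @P_merge p (nth 0%N s l); rewrite q_gt0 /=.
  have qS : (nth 0%N s l <= S)%N.
    by have := sumn_omit_nth (ltn_ord l); lia.
  move=> /(_ qS) /(ler_wpM2r (mulr_ge0 (prodP_ge0 (omit_nth l s)) d_ge0)).
  congr (_ <= _); ring.
apply: le_trans (lerD le1 le2) _.
(* P p.+1 >= N * P p, so that reversing the loop is negligible *)
have pPp : p%:R * P p <= P p.+1 * (p%:R / N%:R).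
  rewrite mulrCA; apply: ler_wpM2l; first exact: ler0n.
  rewrite ler_pdivlMr // mulrC PS; apply: ler_wpDr => //.
  by apply: sumr_ge0 => k _; exact: mulr_ge0.
apply: (@le_trans _ _ ((P p.+1 + P p.+1 * (p%:R / N%:R)) * (prodP s * d) +
    P p.+1 * (prodP s * d) * ((2 * sumn s)%:R / N%:R))).
  by rewrite lerD2r; apply: ler_wpM2r; rewrite ?mulr_ge0 ?prodP_ge0 // lerD2l.
have -> : P p.+1 * prodP s * (c * d) = P p.+1 * (prodP s * d) * c by ring.
rewrite [leLHS](_ : _ = P p.+1 * (prodP s * d) * (1 + (p + 2 * sumn s)%:R / N%:R)); last first.
  by rewrite natrD; ring.
apply: ler_wpM2l; first by rewrite !mulr_ge0 ?prodP_ge0.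
by rewrite lerD2l ler_wpM2r ?invr_ge0 ?ler0n // ler_nat; lia.
Qed.

End TraceMomentBounds.
End SchwingerDyson.

(** * The Gaussian functional on polynomials *)

(** [(m - 1)!!] for even [m] and 0 for odd [m], in the form that integration by
    parts produces. *)
Fixpoint gauss_moment (m : nat) : nat :=
  if m is m'.+1 then (if m' is m''.+1 then m' * gauss_moment m'' else 0)%N else 1%N.

Section GaussianFunctional.
Variables (R : realFieldType) (k : nat).

Definition wick_weight (m : multinom k) : R := \prod_(i < k) (gauss_moment (m i))%:R.

Definition wick_fun (p : mpoly k R) : R :=
  \sum_(m <- msupp p) mcoeff m p * wick_weight m.

Lemma wick_fun_widen (s : seq (multinom k)) (p : mpoly k R) :
  uniq s -> {subset msupp p <= s} ->
  wick_fun p = \sum_(m <- s) mcoeff m p * wick_weight m.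
Proof.
move=> us sub; rewrite [RHS](bigID (fun m => m \in msupp p)) /= [X in _ + X]big1 ?addr0.
  rewrite -[RHS]big_filter; apply: perm_big; apply: uniq_perm; rewrite ?filter_uniq ?msupp_uniq //.
  by move=> m; rewrite mem_filter; case: (boolP (m \in msupp p)) => // /sub ->.
by move=> m /memN_msupp_eq0 ->; rewrite mul0r.
Qed.

Lemma wick_fun_is_linear : linear_for *%R wick_fun.
Proof.
move=> c p q.
pose s := undup (msupp p ++ msupp q ++ msupp (c *: p + q)).
have us : uniq s by exact: undup_uniq.
rewrite (@wick_fun_widen s p) // ?(@wick_fun_widen s q) // ?(@wick_fun_widen s (c *: p + q)) //.
- rewrite mulr_sumr -big_split; apply: eq_bigr => m _ /=.
  by rewrite mcoeffD mcoeffZ mulrDl mulrA.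
- by move=> m h; rewrite mem_undup !mem_cat h !orbT.
- by move=> m h; rewrite mem_undup !mem_cat h !orbT.
- by move=> m h; rewrite mem_undup !mem_cat h.
Qed.

HB.instance Definition _ := GRing.isLinear.Build R (mpoly k R) R *%R wick_fun wick_fun_is_linear.

Lemma wick_funX m : wick_fun (mpolyX R m) = wick_weight m.
Proof. by rewrite /wick_fun msuppX big_seq1 mcoeffX eqxx mul1r. Qed.

Lemma wick_fun1 : wick_fun 1 = 1.
Proof.
by rewrite -mpolyX0 wick_funX /wick_weight big1 // => i _; rewrite mnm0E.
Qed.

(** On monomials this is the recursion [g (m.+2) = m.+1 * g m] in the exponent of
    the variable [i]. *)
Lemma wick_fun_by_parts i p : wick_fun (mpolyX R (mnm1 i) * p) = wick_fun (mderiv i p).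
Proof.
elim/mpolyind: p => [|c m p _ _ IH]; first by rewrite mulr0 mderiv0.
rewrite mulrDr -scalerAr -mpolyXD mderivD mderivZ !linearP /= IH; congr (_ * _ + _).
rewrite mderivX linearZ /= !wick_funX /wick_weight (bigD1 i) //= [in RHS](bigD1 i) //=.
rewrite mnmDE mnmBE mnm1E eqxx mulrA add1n subn1; congr (_ * _).
  by case: (m i) => [|[|j]] //=; rewrite ?mul0r ?mul1r // natrM.
apply: eq_bigr => j ji; rewrite mnmDE mnmBE mnm1E eq_sym (negPf ji).
by rewrite add0n subn0.
Qed.

End GaussianFunctional.

(** * Traces of powers as sums over closed walks *)

Section FfunCons.
Variables (T : finType) (p : nat).

Definition fcons (a : T) (u : {ffun 'I_p -> T}) : {ffun 'I_p.+1 -> T} :=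
  [ffun i => if unlift ord0 i is Some j then u j else a].

Lemma fcons0 a u : fcons a u ord0 = a.
Proof. by rewrite ffunE unlift_none. Qed.

Lemma fconsS a u i : fcons a u (lift ord0 i) = u i.
Proof. by rewrite ffunE liftK. Qed.

Lemma big_ffunS (A : nmodType) (F : {ffun 'I_p.+1 -> T} -> A) :
  \sum_u F u = \sum_a \sum_u F (fcons a u).
Proof.
rewrite pair_big /=.
pose tl (u : {ffun 'I_p.+1 -> T}) := (u ord0, [ffun i => u (lift ord0 i)]).
rewrite (reindex (fun z => fcons z.1 z.2)) //=.
exists tl => [[a u] _|u _].
  by rewrite /tl fcons0; congr pair; apply/ffunP => i; rewrite ffunE fconsS.
apply/ffunP => i; case: (unliftP ord0 i) => [j|] ->; rewrite ?fconsS ?fcons0 //.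
by rewrite ffunE.
Qed.

End FfunCons.

Section MatrixPowerWalks.
Variables (A : comNzRingType) (n : nat).

Lemma matrix_pow_walks (M : 'M[A]_n) p i f : (M ^+ p.+1) i f =
  \sum_(u : {ffun 'I_p.+1 -> 'I_n} | u ord0 == i)
    \prod_(l < p) M (u (widen_ord (leqnSn p) l)) (u (lift ord0 l)) * M (u ord_max) f.
Proof.
elim: p i => [|p IH] i.
  rewrite big_mkcond big_ffunS /= (bigD1 i) //= [X in _ + X]big1 ?addr0; last first.
    by move=> j ji; rewrite big1 // => u _; rewrite fcons0 (negPf ji).
  have u0 : {ffun 'I_0 -> 'I_n} by exact: [ffun=> i].
  rewrite (bigD1 u0) //= fcons0 eqxx [X in _ + X]big1 ?addr0.
    by rewrite big_ord0 mul1r (_ : ord_max = ord0) ?fcons0 ?expr1 //; apply/val_inj.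
  by move=> u /eqP[]; apply/ffunP => -[].
rewrite exprS mxE [RHS]big_mkcond big_ffunS /= [RHS](bigD1 i) //=.
rewrite [X in _ = _ + X]big1 ?addr0; last first.
  by move=> j ji; rewrite big1 // => u _; rewrite fcons0 (negPf ji).
under eq_bigr do rewrite IH mulr_sumr.
rewrite (exchange_big_dep predT) //=; apply: eq_bigr => u _.
rewrite (big_pred1 (u ord0)) /=; last by move=> j; rewrite eq_sym.
rewrite fcons0 eqxx big_ord_recl mulrA; congr (_ * _ * M _ _).
- by rewrite fconsS (_ : widen_ord _ _ = ord0) ?fcons0 //; apply/val_inj.
- apply: eq_bigr => l _.
  rewrite fconsS (_ : widen_ord _ _ = lift ord0 (widen_ord (leqnSn p) l)) ?fconsS //.
  exact/val_inj.
- by rewrite (_ : ord_max = lift ord0 ord_max) ?fconsS //; apply/val_inj.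
Qed.

Lemma trace_pow_walks (M : 'M[A]_n) p : \tr (M ^+ p.+1) =
  \sum_(u : {ffun 'I_p.+1 -> 'I_n}) \prod_(l < p.+1) M (u l) (u (ordS l)).
Proof.
rewrite /mxtrace; under eq_bigr do rewrite matrix_pow_walks.
rewrite (exchange_big_dep predT) //=; apply: eq_bigr => u _.
rewrite (big_pred1 (u ord0)) /=; last by move=> j; rewrite eq_sym.
rewrite big_ord_recr /=; congr (_ * M _ (u _)); last first.
  by apply: val_inj; rewrite /= modnn.
apply: eq_bigr => l _; congr (M _ (u _)); apply: val_inj => /=.
by rewrite modn_small // ltnS ltn_ord.
Qed.

End MatrixPowerWalks.

Section Walks.
Variables (p : nat) (U V : finType).
Implicit Types (u : {ffun 'I_p -> U}) (v : {ffun 'I_p -> V}).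

(** The walk visits [u 0, v 0, u 1, v 1, ...] and closes up, so that the step from
    [v l] leads to [u (ordS l)]. *)
Definition edge_count u v (e : U * V) : nat :=
  \sum_(l < p) (((u l, v l) == e) + ((u (ordS l), v l) == e)).

Definition walk_weight (R : comNzRingType) (mu : nat -> R) u v : R :=
  \prod_e mu (edge_count u v e).

End Walks.

Lemma prod_pow_count (A : comNzRingType) (T : finType) (I : finType) (F : T -> A) (h : I -> T) :
  \prod_i F (h i) = \prod_e F e ^+ (\sum_i (h i == e)).
Proof.
rewrite (eq_bigr (fun e => \prod_i F e ^+ (h i == e))) => [|e _]; last first.
  by rewrite expr_sum.
rewrite exchange_big; apply: eq_bigr => i _ /=.
rewrite (bigD1 (h i)) //= eqxx expr1 big1 ?mulr1 // => e he.
by rewrite eq_sym (negPf he) expr0.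
Qed.

Lemma gram_trace_walks (A : comNzRingType) n N (X : 'M[A]_(n, N)) p :
  \tr ((X *m X^T) ^+ p.+1) =
  \sum_(u : {ffun 'I_p.+1 -> 'I_n}) \sum_(v : {ffun 'I_p.+1 -> 'I_N})
    \prod_e X e.1 e.2 ^+ edge_count u v e.
Proof.
rewrite trace_pow_walks; apply: eq_bigr => u _.
under eq_bigr do rewrite mxE.
rewrite bigA_distr_bigA /=; apply: eq_bigr => v _.
under eq_bigr do rewrite [_^T _ _]mxE.
rewrite big_split /=.
rewrite (prod_pow_count (fun e => X e.1 e.2) (fun l => (u l, v l))).
rewrite (prod_pow_count (fun e => X e.1 e.2) (fun l => (u (ordS l), v l))).
rewrite -big_split; apply: eq_bigr => e _ /=.
by rewrite -exprD -big_split.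
Qed.

(** * Grouping the walks by shape *)

Section Kernels.
Variable I : finType.

(** The kernel of [h] as an idempotent map: every index is sent to a representative
    of its fibre that depends on the fibre only. *)
Definition canon (T : eqType) (h : I -> T) : {ffun I -> I} :=
  [ffun i => odflt i [pick j | h j == h i]].

Lemma canonK (T : eqType) (h : I -> T) i : h (canon h i) = h i.
Proof. by rewrite ffunE; case: pickP => [j /eqP|/(_ i)] //=; rewrite eqxx. Qed.

Lemma canon_eq (T : eqType) (h : I -> T) i j : (canon h i == canon h j) = (h i == h j).
Proof.
apply/eqP/eqP => [e|e]; first by rewrite -(canonK h i) e canonK.
rewrite !ffunE (eq_pick (_ : _ =1 (fun l => h l == h j))) => [|l]; last by rewrite e.
by case: pickP => [//|/(_ j)]; rewrite eqxx.
Qed.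

Lemma eq_canon (T T' : eqType) (h : I -> T) (h' : I -> T') :
  (forall i j, (h i == h j) = (h' i == h' j)) -> canon h = canon h'.
Proof.
by move=> e; apply/ffunP => i; rewrite !ffunE (eq_pick (e^~ i)).
Qed.

Lemma canon_canon (T : eqType) (h : I -> T) : canon (canon h) = canon h.
Proof. by apply: eq_canon => i j; exact: canon_eq. Qed.

(** The left-hand side only depends on the partition of [I] into the fibres of [h],
    which the right-hand side makes visible. *)
Lemma prod_fibers (A : comNzRingType) (T : finType) (h : I -> T) (mu : nat -> A) :
  mu 0%N = 1 ->
  \prod_e mu (\sum_i (h i == e))%N = \prod_(i | canon h i == i) mu (\sum_j (h j == h i))%N.
Proof.
move=> mu0; rewrite [RHS](partition_big h predT) //=; apply: eq_bigr => e _.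
have [/codomP[i ->]|he] := boolP (e \in codom h).
  rewrite [RHS](big_pred1 (canon h i)) ?canonK // => j /=.
  rewrite -[h j == h i]canon_eq; apply/andP/eqP => [[/eqP hj /eqP hij]|->].
    by rewrite -hij hj.
  have cc : canon h (canon h i) = canon h i by apply/eqP; rewrite canon_eq canonK.
  by rewrite cc.
rewrite [RHS]big_pred0 => [|i]; last first.
  by apply/negP => /andP[_ /eqP hi]; rewrite -hi codom_f in he.
rewrite big1 ?mu0 // => i _; case: eqP => // hi.
by rewrite -hi codom_f in he.
Qed.

Definition distinct (T : finType) (h : I -> T) : nat := #|codom h|.

(** A map with kernel [c] is [c] followed by an injection of the image of [c]. *)
Lemma card_canon_fiber (T : finType) (c : {ffun I -> I}) : canon c = c ->
  #|[set u : {ffun I -> T} | canon u == c]| = (#|T| ^_ distinct c)%N.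
Proof.
move=> cc; pose D : finType := {x | x \in codom c}.
have cD i : c i \in codom c by exact: codom_f.
pose ext (f : {ffun D -> T}) : {ffun I -> T} := [ffun i => f (Sub (c i) (cD i))].
have -> : [set u : {ffun I -> T} | canon u == c] = ext @: [set f : {ffun D -> T} | injectiveb f].
  apply/setP => u; rewrite inE; apply/eqP/imsetP => [uc|[f]].
    exists [ffun x : D => u (val x)].
      rewrite inE; apply/injectiveP => -[x hx] [y hy]; rewrite !ffunE /= => /eqP uxy.
      apply: val_inj => /=; move: uxy; rewrite -canon_eq uc => /eqP.
      case/codomP: hx => i ->; case/codomP: hy => j ->.
      have cid l : c (c l) = c l by have := canonK c l; rewrite cc.
      by rewrite !cid.
    by apply/ffunP => i; rewrite !ffunE /= -[in RHS]uc canonK.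
  rewrite inE => /injectiveP fi ->; rewrite -[RHS]cc; apply: eq_canon => i j.
  by rewrite !ffunE (inj_eq fi) -(inj_eq val_inj).
rewrite card_in_imset; first by rewrite card_inj_ffuns card_sig.
move=> f g _ _ /ffunP e; apply/ffunP => -[x hx].
case/codomP: (hx) => i xi; have := e i; rewrite !ffunE.
by rewrite (_ : Sub (c i) (cD i) = Sub x hx) //; apply: val_inj.
Qed.

Lemma sum_by_canon (A : nmodType) (T : finType) (F : {ffun I -> I} -> A) :
  \sum_(u : {ffun I -> T}) F (canon u) =
  \sum_(c : {ffun I -> I} | canon c == c) F c *+ (#|T| ^_ distinct c).
Proof.
rewrite (partition_big (fun u : {ffun I -> T} => canon u) (fun c => canon c == c)) /=; last first.
  by move=> u _; rewrite canon_canon.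
apply: eq_bigr => c /eqP cc; rewrite (eq_bigr (fun=> F c)) => [|u /eqP -> //].
by rewrite sumr_const -(card_canon_fiber T cc) cardsE.
Qed.

End Kernels.

Section WalkShapes.
Variable p : nat.

Definition step (U V : Type) (u : 'I_p -> U) (v : 'I_p -> V) (x : 'I_p * bool) : U * V :=
  (u (if x.2 then ordS x.1 else x.1), v x.1).

Lemma edge_countE (U V : finType) (u : {ffun 'I_p -> U}) (v : {ffun 'I_p -> V}) e :
  edge_count u v e = (\sum_x (step u v x == e))%N.
Proof.
rewrite -(pair_bigA _ (fun l b => (step u v (l, b) == e) : nat)) /=.
by apply: eq_bigr => l _; rewrite big_bool addnC.
Qed.

Lemma walk_weight_canon (R : comNzRingType) (mu : nat -> R) (U V : finType)
  (u : {ffun 'I_p -> U}) (v : {ffun 'I_p -> V}) : mu 0%N = 1 ->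
  walk_weight mu u v = walk_weight mu (canon u) (canon v).
Proof.
move=> mu0; have eq_step x y :
  (step u v x == step u v y) = (step (canon u) (canon v) x == step (canon u) (canon v) y).
  by rewrite !xpair_eqE !canon_eq.
rewrite /walk_weight.
under eq_bigr do rewrite edge_countE.
under [RHS]eq_bigr do rewrite edge_countE.
rewrite !prod_fibers // (eq_canon eq_step); apply: eq_bigr => x _; congr (mu _).
by apply: eq_bigr => y _; rewrite eq_step.
Qed.

Definition walk_sum (R : comNzRingType) (mu : nat -> R) (n N : nat) : R :=
  \sum_(u : {ffun 'I_p -> 'I_n}) \sum_(v : {ffun 'I_p -> 'I_N}) walk_weight mu u v.

Lemma walk_sum_shapes (R : comNzRingType) (mu : nat -> R) n N : mu 0%N = 1 ->
  walk_sum mu n N =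
  \sum_(c : {ffun 'I_p -> 'I_p} | canon c == c) \sum_(d : {ffun 'I_p -> 'I_p} | canon d == d)
    walk_weight mu c d *+ (n ^_ distinct c * N ^_ distinct d).
Proof.
move=> mu0; rewrite /walk_sum.
under eq_bigr do under eq_bigr do rewrite walk_weight_canon //.
pose shapes_with (c : {ffun 'I_p -> 'I_p}) : R := \sum_(d : {ffun 'I_p -> 'I_p} | canon d == d)
  walk_weight mu c d *+ (#|'I_N| ^_ distinct d).
under eq_bigr => u _ do
  rewrite (sum_by_canon _ (fun d : {ffun 'I_p -> 'I_p} => walk_weight mu (canon u) d)).
rewrite (sum_by_canon _ shapes_with) {}/shapes_with.
apply: eq_bigr => c _; rewrite -sumrMnl; apply: eq_bigr => d _.
by rewrite -mulrnA mulnC !card_ord.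
Qed.

End WalkShapes.

(** * Vertices and edges of a closed walk *)

Section WalkEdges.
Variables (U V : finType).

Lemma card_cons (T : finType) (x : T) (s : seq T) : #|x :: s| = ((x \notin s) + #|s|)%N.
Proof. by rewrite -cardU1; apply: eq_card => y; rewrite !inE. Qed.

(** Vertices and edges seen along the first [2k] steps of a walk, latest first. *)
Fixpoint walk_rows (a : nat -> U) k : seq U :=
  if k is k'.+1 then a k :: walk_rows a k' else [:: a 0%N].
Fixpoint walk_cols (b : nat -> V) k : seq V :=
  if k is k'.+1 then b k' :: walk_cols b k' else [::].
Fixpoint walk_edges (a : nat -> U) (b : nat -> V) k : seq (U * V) :=
  if k is k'.+1 then (a k, b k') :: (a k', b k') :: walk_edges a b k' else [::].

Lemma mem_walk_edges a b k e : e \in walk_edges a b k ->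
  (e.1 \in walk_rows a k) && (e.2 \in walk_cols b k).
Proof.
elim: k => [|k IH] //=; rewrite !inE => /or3P[/eqP->|/eqP->|/IH/andP[e1 e2]] /=.
- by rewrite !eqxx.
- by rewrite eqxx andbT; case: k {IH} => [|k] /=; rewrite !inE eqxx ?orbT.
- by rewrite e1 e2 !orbT.
Qed.

(** A step towards a new vertex passes through a new edge; the starting vertex
    accounts for the successor. *)
Lemma vertices_le_edges a b k : (#|walk_rows a k| + #|walk_cols b k| <= #|walk_edges a b k|.+1)%N.
Proof.
elim: k => [|k IH] /=; first by rewrite card_cons !eq_card0.
rewrite !card_cons.
have h1 : ((a k.+1 \notin walk_rows a k) <=
    ((a k.+1, b k) \notin (a k, b k) :: walk_edges a b k))%N.
  case: (boolP (a k.+1 \in _)) => //= ak; rewrite lt0b; apply/negP.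
  rewrite inE => /orP[/eqP[e]|/mem_walk_edges/andP[/=]]; last by rewrite (negPf ak).
  by move: ak; rewrite e; case: (k) => [|j] /=; rewrite !inE eqxx.
have h2 : ((b k \notin walk_cols b k) <= ((a k, b k) \notin walk_edges a b k))%N.
  case: (boolP (b k \in _)) => //= bk; rewrite lt0b; apply/negP.
  by move=> /mem_walk_edges/andP[_ /=]; rewrite (negPf bk).
by rewrite addnACA; apply: leq_trans (leq_add (leq_add h1 h2) IH) _; rewrite addnS addnA.
Qed.

Lemma distinct_le_steps q (u : {ffun 'I_q.+1 -> U}) (v : {ffun 'I_q.+1 -> V}) :
  (distinct u + distinct v <= #|codom (step u v)|.+1)%N.
Proof.
pose a l := u (inord (l %% q.+1)); pose b l := v (inord l).
have rowsP k l : (l <= k)%N -> a l \in walk_rows a k.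
  elim: k => [|k IH]; first by rewrite leqn0 => /eqP ->; rewrite inE.
  by rewrite leq_eqVlt ltnS => /orP[/eqP->|/IH h]; rewrite inE ?eqxx ?h ?orbT.
have colsP k l : (l < k)%N -> b l \in walk_cols b k.
  elim: k => [//|k IH].
  by rewrite ltnS leq_eqVlt => /orP[/eqP->|/IH h]; rewrite inE ?eqxx ?h ?orbT.
have edgesP k e : (k <= q.+1)%N -> e \in walk_edges a b k -> e \in codom (step u v).
  elim: k => [//|k IH] kq; rewrite !inE => /or3P[/eqP->|/eqP->|/IH->//]; last exact: ltnW.
    have -> : (a k.+1, b k) = step u v (inord k, true).
      rewrite /step /a /b /=; congr (u _, _); apply: val_inj.
      by rewrite /= inordK ?ltn_mod // inordK.
    exact: codom_f.
  have -> : (a k, b k) = step u v (inord k, false).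
    by rewrite /step /a /b /= modn_small.
  exact: codom_f.
apply: leq_trans (leq_trans (vertices_le_edges a b q.+1) _).
  apply: leq_add; apply: subset_leq_card; apply/fintype.subsetP => x /codomP[i ->].
    have -> : u i = a i by rewrite /a modn_small // inord_val.
    by apply: rowsP; exact: ltnW.
  have -> : v i = b i by rewrite /b inord_val.
  exact: colsP.
by rewrite ltnS; apply: subset_leq_card; apply/fintype.subsetP => x; exact: edgesP.
Qed.

Section Compare.
Variables (p : nat) (u : {ffun 'I_p.+1 -> U}) (v : {ffun 'I_p.+1 -> V}).

Lemma sum_edge_count : (\sum_e edge_count u v e = 2 * p.+1)%N.
Proof.
under eq_bigr do rewrite edge_countE.
rewrite exchange_big /= (eq_bigr (fun=> 1%N)) => [|x _].
  by rewrite sum1_card card_prod card_ord card_bool mulnC.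
rewrite (bigD1 (step u v x)) //= eqxx big1 // => e.
by rewrite eq_sym => /negPf ->.
Qed.

Lemma edge_count_gt0 e : (0 < edge_count u v e)%N = (e \in codom (step u v)).
Proof.
rewrite edge_countE lt0n sum_nat_eq0 negb_forall.
apply/existsP/codomP => [[x p0]|[x ->]]; exists x; last by rewrite eqxx.
by apply/esym/eqP; case: (step u v x == e) p0.
Qed.

(** Edge by edge, [K mu (2m) <= K^m nu (2m)], and the number of edges is at least
    the number of vertices minus 1, while the [m]'s sum to at most [p.+1]. *)
Lemma walk_weight_compare (R : realDomainType) (mu nu : nat -> R) (K : R) :
  1 <= K -> (forall k, 0 <= mu k) -> (forall k, 0 <= nu k) ->
  mu 0%N = 1 -> nu 0%N = 1 -> (forall k, odd k -> mu k = 0) ->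
  (forall m, (m <= p)%N -> mu (2 * m.+1)%N <= K ^+ m * nu (2 * m.+1)%N) ->
  K ^+ (distinct u + distinct v) * walk_weight mu u v <= K ^+ p.+2 * walk_weight nu u v.
Proof.
move=> K1 mu_ge0 nu_ge0 mu0 nu0 mu_odd mu_nu.
have K0 : 0 <= K by exact: le_trans K1.
have W_ge0 : 0 <= walk_weight mu u v by apply: prodr_ge0.
have W'_ge0 : 0 <= walk_weight nu u v by apply: prodr_ge0.
apply: (@le_trans _ _ (K ^+ #|codom (step u v)|.+1 * walk_weight mu u v)).
  by apply: ler_wpM2r => //; apply: ler_weXn2l => //; exact: distinct_le_steps.
rewrite exprS [in leRHS]exprS -!mulrA; apply: ler_wpM2l => //.
have half_sum : (\sum_e (edge_count u v e)./2 <= p.+1)%N.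
  rewrite -(leq_pmul2l (isT : 0 < 2)%N) -sum_edge_count big_distrr /=.
  by apply: leq_sum => e _; rewrite mul2n -[leqRHS]odd_double_half leq_addl.
apply: (@le_trans _ _ (K ^+ (\sum_e (edge_count u v e)./2)%N * walk_weight nu u v)).
  have -> : #|codom (step u v)| = (\sum_e (0 < edge_count u v e : nat))%N.
    rewrite -sum1_card big_mkcond /=; apply: eq_bigr => e _.
    by rewrite edge_count_gt0; case: (_ \in _).
  rewrite /walk_weight !expr_sum -!big_split /=; apply: ler_prod => e _.
  have e_le : (edge_count u v e <= 2 * p.+1)%N.
    by rewrite -sum_edge_count (bigD1 e) //= leq_addr.
  rewrite mulr_ge0 ?exprn_ge0 //=.
  case: (posnP (edge_count u v e)) e_le => [->|e_gt0] e_le; first by rewrite !expr0 mu0 nu0.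
  have [oe|ee] := boolP (odd (edge_count u v e)).
    by rewrite mu_odd // mulr0 mulr_ge0 ?exprn_ge0.
  move: e_gt0 e_le; rewrite -(even_halfK ee) -mul2n mul2n doubleK.
  case: (_./2) => [//|m] _ mp; rewrite -mul2n exprS -mulrA expr1; apply: ler_wpM2l => //.
  by apply: mu_nu; move: mp; lia.
by apply: ler_wpM2r => //; apply: ler_weXn2l.
Qed.

End Compare.
End WalkEdges.

(** * Gaussian walk sums against the Marchenko-Pastur profile *)

Section MarchenkoPasturProfile.
Variable R : realType.

(** The main term of the trace of [(X X^T)^q]; extended to real dimensions so that it
    can be rescaled. *)
Definition mp_profile (x y : R) q : R := x * y ^+ q * mp_seq (x / y) q.
Local Notation P := mp_profile.

Section Fixed.
Variables (x y : R).
Hypothesis (x_gt0 : 0 < x) (y_gt0 : 0 < y).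
Let g_gt0 : 0 < x / y. Proof. exact: divr_gt0. Qed.
Let y_neq0 : y != 0. Proof. by rewrite gt_eqF. Qed.

Let seq0 : mp_seq (x / y) 0 = 1. Proof. by []. Qed.
Let seq1 : mp_seq (x / y) 1 = 1. Proof. exact: mp_moment1. Qed.
Let seq_lin k : (k.+3)%:R * mp_seq (x / y) k.+2 =
  (2 * k + 3)%:R * (1 + x / y) * mp_seq (x / y) k.+1 - k%:R * (1 - x / y) ^+ 2 * mp_seq (x / y) k.
Proof. exact: mp_moment_lin. Qed.

Lemma mp_seq_gt0 q : 0 < mp_seq (x / y) q.
Proof. exact: (linrec_gt0 g_gt0 seq0 seq1 seq_lin). Qed.

Lemma mp_profile0 : P x y 0 = x.
Proof. by rewrite /P expr0 mulr1 mulr1. Qed.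

Lemma mp_profile_gt0 q : 0 < P x y q.
Proof. by rewrite /P !mulr_gt0 ?exprn_gt0 ?mp_seq_gt0. Qed.

Lemma mp_profileS q :
  P x y q.+1 = y * P x y q + \sum_(k < q) P x y k.+1 * P x y (q - k.+1)%N.
Proof.
rewrite /P (linrec_convolution g_gt0 seq0 seq1 seq_lin) mulrDr.
congr (_ + _); first by rewrite exprS; ring.
rewrite !mulr_sumr; apply: eq_bigr => k _.
have -> : y ^+ q.+1 = y * (y ^+ k.+1 * y ^+ (q - k.+1)) by rewrite -exprD subnKC // exprS.
by field.
Qed.

Lemma mp_profile_merge p q S : (S ^ 2)%:R <= x -> (0 < q <= S)%N ->
  y * P x y (p + q) <= P x y p.+1 * P x y q.
Proof.
move=> Sx /andP[]; case: q => // q _ qS; rewrite /P addnS.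
have h := linrec_merge g_gt0 seq0 seq1 seq_lin p q.
have qx : (q.+1 * q.+2)%:R / 2 <= x.
  apply: le_trans Sx; rewrite ler_pdivrMr // -natrM ler_nat.
  have : (q.+1 ^ 2 <= S ^ 2)%N by rewrite leq_exp2r.
  by rewrite !expnS !expn0; nia.
have bb : 0 <= mp_seq (x / y) p.+1 * mp_seq (x / y) q.+1.
  by rewrite mulr_ge0 // ltW // mp_seq_gt0.
have {h} : mp_seq (x / y) (p + q).+1 <= x * (mp_seq (x / y) p.+1 * mp_seq (x / y) q.+1).
  by apply: le_trans h _; exact: ler_wpM2r.
have c0 : 0 <= y * x * y ^+ (p + q).+1 by rewrite !mulr_ge0 ?exprn_ge0 // ltW.
move=> /(ler_wpM2l c0); congr (_ <= _); first by ring.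
by rewrite !exprS exprD; ring.
Qed.

End Fixed.

Lemma mp_profile_scale (c x y : R) q : c != 0 -> P (c * x) (c * y) q = c ^+ q.+1 * P x y q.
Proof.
by move=> c0; rewrite /P -mulf_div divff // mul1r exprMn exprS; ring.
Qed.

(** Monotonicity in [y] is not visible on the formula, but the recursion has
    nonnegative coefficients in [x] and [y]. *)
Lemma mp_profile_le (x y x' y' : R) q : 0 < x -> 0 < y -> x <= x' -> y <= y' ->
  P x y q <= P x' y' q.
Proof.
move=> x0 y0 xx yy; have x0' := lt_le_trans x0 xx; have y0' := lt_le_trans y0 yy.
elim/ltn_ind: q => -[|q] IH; first by rewrite !mp_profile0.
rewrite !mp_profileS //; apply: lerD.
  by apply: ler_pM => //; [exact: ltW | exact/ltW/mp_profile_gt0 | exact: IH].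
apply: ler_sum => k _; apply: ler_pM; try exact/ltW/mp_profile_gt0.
  by apply: IH; rewrite ltnS.
by apply: IH; rewrite ltnS leq_subr.
Qed.

End MarchenkoPasturProfile.

Section GaussianWalks.
Variables (R : realType) (n N : nat).
Local Notation k := #|{: 'I_n * 'I_N}|.

Definition gvar (i : 'I_n) (j : 'I_N) : mpoly k R := mpolyX R (mnm1 (enum_rank (i, j))).

Definition gder (i : 'I_n) (j : 'I_N) : {additive mpoly k R -> mpoly k R} :=
  mderiv (enum_rank (i, j)).

Local Notation L := (@wick_fun R k).

Definition gauss_mu (m : nat) : R := (gauss_moment m)%:R.

Lemma gder_gvar i j a b : gder i j (gvar a b) = ((i == a) && (j == b))%:R.
Proof.
rewrite /gder /gvar /= mderivX mnm1E (inj_eq enum_rank_inj) eq_sym xpair_eqE.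
case: andP => [[/eqP-> /eqP->]|_] /=; last by rewrite scale0r.
rewrite scale1r (_ : mnm_sub _ _ = mnm0) ?mpolyX0 //.
by apply/mnmP => l; rewrite mnmBE mnm0E subnn.
Qed.

Lemma gauss_walk_sum p :
  walk_sum p.+1 gauss_mu n N = trmom gvar L [:: p.+1].
Proof.
rewrite /trmom /multitr big_seq1 /powtr gram_trace_walks raddf_sum.
apply: eq_bigr => u _; rewrite raddf_sum; apply: eq_bigr => v _.
rewrite (eq_bigr (fun e => mpolyX R (mnm1 (enum_rank e)) ^+ edge_count u v e)); last first.
  by move=> [i j] _; rewrite mxE.
rewrite mprodXnE [RHS]/= wick_funX /wick_weight /walk_weight.
rewrite (reindex (@enum_rank {: 'I_n * 'I_N})) /=; last first.
  exact/onW_bij/enum_rank_bij.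
apply: eq_bigr => e _; rewrite /gauss_mu mnm_sumE (bigD1 e) //= big1 ?addn0.
  by rewrite mulmnE mnm1E eqxx mul1n.
by move=> e' ee; rewrite mulmnE mnm1E (inj_eq enum_rank_inj) (negPf ee) mul0n.
Qed.

Hypothesis (n_gt0 : (0 < n)%N) (N_gt0 : (0 < N)%N).
Let n0 : 0 < n%:R :> R. Proof. by rewrite ltr0n. Qed.
Let N0 : 0 < N%:R :> R. Proof. by rewrite ltr0n. Qed.

Lemma gauss_walk_sum_ge p :
  mp_profile n%:R N%:R p.+1 <= walk_sum p.+1 gauss_mu n N.
Proof.
rewrite gauss_walk_sum.
have := @trmom_ge R (mpoly k R) n N gvar gder L _ _ _ _ (mp_profile n%:R N%:R) _ _ _ [:: p.+1].
rewrite big_seq1; apply.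
- by move=> i j a b; exact: mderivM.
- exact: gder_gvar.
- by move=> i j a; exact: wick_fun_by_parts.
- exact: wick_fun1.
- exact: mp_profile0.
- by move=> q; exact/ltW/mp_profile_gt0.
- by move=> q; exact: mp_profileS.
Qed.

Lemma gauss_walk_sum_le p : (p.+1 ^ 2 <= n)%N ->
  walk_sum p.+1 gauss_mu n N <=
  mp_profile n%:R N%:R p.+1 * (1 + (2 * p.+1)%:R / N%:R) ^+ p.+1.
Proof.
move=> pn; rewrite gauss_walk_sum.
have := @trmom_le R (mpoly k R) n N gvar gder L _ _ _ _
  (mp_profile n%:R N%:R) p.+1 N_gt0 _ _ _ _ [:: p.+1].
rewrite big_seq1 /= addn0; apply => //.
- by move=> i j a b; exact: mderivM.
- exact: gder_gvar.
- by move=> i j a; exact: wick_fun_by_parts.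
- exact: wick_fun1.
- exact: mp_profile0.
- by move=> q; exact/ltW/mp_profile_gt0.
- by move=> q; exact: mp_profileS.
- by move=> q r rp; apply: mp_profile_merge rp => //; rewrite ler_nat.
Qed.

End GaussianWalks.

(** * Walk sums of general entries *)

Section WalkSumBounds.
Variables (R : realType) (p : nat) (mu : nat -> R).
Local Notation q := p.+1.
Hypothesis mu0 : mu 0%N = 1.
Hypothesis mu_ge0 : forall k, 0 <= mu k.
Hypothesis mu_odd : forall k, odd k -> mu k = 0.

Lemma gauss_mu_ge0 k : 0 <= gauss_mu R k.
Proof. exact: ler0n. Qed.

Lemma gauss_moment_odd k : odd k -> gauss_moment k = 0%N.
Proof.
elim/ltn_ind: k => -[|[|k]] IH //= ok.
by rewrite IH ?muln0 //; move: ok; rewrite negbK.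
Qed.

Lemma distinct_le (T : finType) (c : {ffun 'I_q -> T}) : (distinct c <= q)%N.
Proof. by rewrite /distinct -[leqRHS]card_ord; exact: leq_image_card. Qed.

(** The shift by [q] makes every factor of the falling factorial at least [n / K]. *)
Lemma ffact_le_scaled K a n : (0 < K)%N -> (a <= q)%N ->
  (n ^_ a <= K ^ a * (n %/ K + q) ^_ a)%N.
Proof.
move=> K0 aq; rewrite !ffact_prod -[X in (K ^ X * _)%N]card_ord -prod_nat_const -big_split /=.
apply: leq_prod => i _; apply: leq_trans (leq_subr _ _) _.
apply: leq_trans (ltnW (ltn_ceil n K0)) _; rewrite mulnC leq_pmul2l //.
by have := ltn_ord i; move: aq; lia.
Qed.

(** Shape by shape, the factor [K^(a+b)] of the comparison of weights pays for
    dividing both dimensions by [K]. *)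
Lemma walk_sum_le_gauss K n N : (0 < K)%N ->
  (forall m, (m <= p)%N -> mu (2 * m.+1) <= K%:R ^+ m * gauss_mu R (2 * m.+1)) ->
  walk_sum q mu n N <= K%:R ^+ q.+1 * walk_sum q (gauss_mu R) (n %/ K + q) (N %/ K + q).
Proof.
move=> K0 mu_le; rewrite !walk_sum_shapes //.
rewrite mulr_sumr; apply: ler_sum => c _; rewrite mulr_sumr; apply: ler_sum => d _.
have K1 : 1 <= K%:R :> R by rewrite ler1n.
have := walk_weight_compare c d K1 mu_ge0 gauss_mu_ge0 mu0 erefl mu_odd mu_le.
rewrite -(mulr_natl (walk_weight mu c d)) -(mulr_natl (walk_weight (gauss_mu R) c d)).
move=> /(ler_wpM2l (ler0n R ((n %/ K + q) ^_ distinct c * (N %/ K + q) ^_ distinct d))) h.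
rewrite [leRHS]mulrCA; apply: le_trans h.
rewrite mulrA; apply: ler_wpM2r; first exact: prodr_ge0.
rewrite -natrX -natrM ler_nat expnD mulnACA.
by apply: leq_mul; rewrite mulnC ffact_le_scaled ?distinct_le.
Qed.

(** By homogeneity [K^(q+1) P(n', N') = P(K n', K N')], and [K n'], [K N'] exceed
    [n], [N] by a factor [1 + O(q/m)] only. *)
Lemma walk_sum_le (K n N m : nat) : (0 < K)%N -> (0 < m)%N -> (m <= n)%N -> (m <= N)%N ->
  (K * q ^ 2 <= n)%N ->
  (forall m, (m <= p)%N -> mu (2 * m.+1) <= K%:R ^+ m * gauss_mu R (2 * m.+1)) ->
  walk_sum q mu n N <=
  mp_profile n%:R N%:R q * (1 + (2 * K * q)%:R / m%:R) ^+ (2 * q).+1.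
Proof.
move=> K0 m0 mn mN Kq mu_le.
set n' := (n %/ K + q)%N; set N' := (N %/ K + q)%N.
have [n'0 N'0] : (0 < n')%N /\ (0 < N')%N by rewrite /n' /N' !addnS.
have qn' : (q ^ 2 <= n')%N.
  apply: leq_trans (leq_addr _ _); rewrite leq_divRL //; by rewrite mulnC.
have mR : 0 < m%:R :> R by rewrite ltr0n.
have KR : 0 < K%:R :> R by rewrite ltr0n.
set t : R := (2 * K * q)%:R / m%:R.
have t0 : 0 <= t by rewrite divr_ge0 ?ler0n.
have Kx x : (m <= x)%N -> (K * (x %/ K + q))%:R <= (1 + t) * x%:R :> R.
  move=> mx; rewrite mulnDr natrD mulrDl mul1r; apply: lerD.
    by rewrite ler_nat mulnC leq_divM.
  rewrite /t mulrAC ler_pdivlMr // -!natrM ler_nat.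
  by apply: leq_mul => //; rewrite -mulnA leq_pmull.
apply: le_trans (walk_sum_le_gauss n N K0 mu_le) _.
have gb : walk_sum q (gauss_mu R) n' N' <=
    mp_profile n'%:R N'%:R q * (1 + (2 * q)%:R / N'%:R) ^+ q by exact: gauss_walk_sum_le.
apply: le_trans (ler_wpM2l (exprn_ge0 _ (ltW KR)) gb) _.
rewrite mulrA -mp_profile_scale ?gt_eqF // -!natrM.
have mx x : (m <= x)%N -> 0 < x%:R :> R by move=> h; rewrite ltr0n (leq_trans m0).
have t1 : 0 < 1 + t by rewrite ltr_pwDl.
have -> : (1 + t) ^+ (2 * q).+1 = (1 + t) ^+ q.+1 * (1 + t) ^+ q.
  by rewrite -exprD addSn mul2n addnn.
rewrite [leRHS]mulrA [X in _ <= X * _]mulrC -mp_profile_scale ?gt_eqF //.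
apply: ler_pM; rewrite ?exprn_ge0 ?addr_ge0 ?divr_ge0 ?ler0n //.
- by apply/ltW/mp_profile_gt0; rewrite ltr0n muln_gt0 K0.
- by apply: mp_profile_le; rewrite ?ltr0n ?muln_gt0 ?K0 ?Kx.
apply: lerXn2r; rewrite ?nnegrE ?addr_ge0 ?divr_ge0 ?ler0n // lerD2l /t.
rewrite ler_pdivrMr ?ltr0n // mulrAC ler_pdivlMr // -!natrM ler_nat.
have NK : (N <= K * N')%N.
  by apply: leq_trans (ltnW (ltn_ceil N K0)) _; rewrite mulnC leq_pmul2l // /N' addnS ltnS leq_addr.
have : (m <= K * N')%N by exact: leq_trans NK.
by move=> /(leq_mul (leqnn (2 * q))); rewrite !mulnA (mulnAC 2 K).
Qed.

Lemma ffact_ge_scaled H a n m : (0 < m)%N -> (q <= m)%N -> (m <= n)%N -> (a <= q)%N ->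
  ((H * n) ^_ a)%:R * (1 - q%:R / m%:R) ^+ q <= H%:R ^+ a * (n ^_ a)%:R :> R.
Proof.
move=> m0 qm mn aq; set t : R := 1 - _.
have mR : 0 < m%:R :> R by rewrite ltr0n.
have t0 : 0 <= t by rewrite subr_ge0 ler_pdivrMr // mul1r ler_nat.
have t1 : t <= 1 by rewrite lerBlDr lerDl divr_ge0 ?ler0n.
apply: (@le_trans _ _ (((H * n) ^_ a)%:R * t ^+ a)).
  by apply: ler_wpM2l => //; exact: ler_wiXn2l.
rewrite !ffact_prod !natr_prod.
have pc (z : R) : z ^+ a = \prod_(i < a) z by rewrite prodr_const card_ord.
rewrite !pc -!big_split /=; apply: ler_prod => i _; rewrite mulr_ge0 //=.
apply: (@le_trans _ _ ((H * n)%:R * t)).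
  by apply: ler_wpM2r => //; rewrite ler_nat leq_subr.
rewrite natrM -mulrA; apply: ler_wpM2l => //.
have iq : (i <= q)%N by apply: leq_trans aq; apply: ltnW.
rewrite natrB; last by apply: leq_trans iq (leq_trans qm mn).
rewrite /t mulrBr mulr1 lerD2l lerN2 mulrCA -[leLHS]mulr1.
apply: ler_pM; rewrite ?ler0n // ?ler_nat // ler_pdivlMr // mul1r ler_nat //.
Qed.

Lemma gauss_moment_le m : (m <= p)%N -> (gauss_moment (2 * m.+1) <= (2 * q) ^ m)%N.
Proof.
elim: m => [//|m IH] mp; rewrite mulnS [gauss_moment _]/= expnS; apply: leq_mul.
  by move: mp; lia.
by apply: IH; exact: ltnW.
Qed.

(** The comparison of weights is used with the Gaussian weight as the smaller one
    and the constant [H = 2 q], in the dimensions [H n], [H N]: there homogeneity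
    provides the factor [H^(q+1)] that the comparison costs. *)
Lemma walk_sum_ge (n N m : nat) : (0 < m)%N -> (q <= m)%N -> (m <= n)%N -> (m <= N)%N ->
  (forall j, (j <= p)%N -> 1 <= mu (2 * j.+1)) ->
  mp_profile n%:R N%:R q * (1 - q%:R / m%:R) ^+ (2 * q) <= walk_sum q mu n N.
Proof.
move=> m0 qm mn mN mu_ge1; set t : R := 1 - _; pose H := (2 * q)%N.
have mR : 0 < m%:R :> R by rewrite ltr0n.
have t0 : 0 <= t by rewrite subr_ge0 ler_pdivrMr // mul1r ler_nat.
have H1 : 1 <= H%:R :> R by rewrite ler1n.
have H0 : 0 < H%:R :> R by exact: lt_le_trans H1.
have Hq : 0 < H%:R ^+ q.+1 :> R by exact: exprn_gt0.
have n0 : (0 < H * n)%N by rewrite muln_gt0 (leq_trans m0 mn).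
have N0 : (0 < H * N)%N by rewrite muln_gt0 (leq_trans m0 mN).
rewrite -(ler_pM2l Hq) mulrA -mp_profile_scale ?gt_eqF // -!natrM.
apply: (@le_trans _ _ (walk_sum q (gauss_mu R) (H * n) (H * N) * t ^+ (2 * q))).
  by apply: ler_wpM2r; [exact: exprn_ge0 | exact: gauss_walk_sum_ge].
rewrite !walk_sum_shapes // mulr_suml mulr_sumr; apply: ler_sum => c _.
rewrite mulr_suml mulr_sumr; apply: ler_sum => d _.
have gauss_odd k : odd k -> gauss_mu R k = 0.
  by move=> ok; rewrite /gauss_mu gauss_moment_odd.
have g_le j : (j <= p)%N -> gauss_mu R (2 * j.+1) <= H%:R ^+ j * mu (2 * j.+1).
  move=> jp; apply: (@le_trans _ _ (H%:R ^+ j)).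
    by rewrite /gauss_mu -natrX ler_nat gauss_moment_le.
  by rewrite ler_peMr ?exprn_ge0 ?mu_ge1 // ltW.
have h := walk_weight_compare c d H1 gauss_mu_ge0 mu_ge0 erefl mu0 gauss_odd g_le.
rewrite -(mulr_natl (walk_weight mu c d)) -(mulr_natl (walk_weight (gauss_mu R) c d)).
have {}h := ler_wpM2l (ler0n R (n ^_ distinct c * N ^_ distinct d)) h.
rewrite [leRHS]mulrCA; apply: le_trans h; rewrite mulrAC mulrA.
apply: ler_wpM2r; first exact: prodr_ge0.
have := ler_pM _ _ (ffact_ge_scaled H m0 qm mn (distinct_le c))
  (ffact_ge_scaled H m0 qm mN (distinct_le d)).
rewrite -/t mul2n -addnn exprD natrM natrM exprD => hh.
rewrite mulrACA; apply: le_trans (hh _ _) _; try by rewrite mulr_ge0 ?exprn_ge0.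
by rewrite mulrACA mulrC.
Qed.

End WalkSumBounds.

Local Open Scope classical_set_scope.
Local Open Scope ring_scope.

(** * Expectations of products of independent variables *)

Section IndependentProducts.
Local Open Scope ereal_scope.
Context d (T : measurableType d) (R : realType) (P : probability T R).

Import HBNNSimple.

(** From indicators to nonnegative functions of [X], by simple approximation and
    monotone convergence. *)
Lemma ge0_integral_mul_indep (W X : T -> R) (c : R) (f : R -> R) :
  measurable_fun setT W -> (forall w, (0 <= W w)%R) -> (0 <= c)%R ->
  measurable_fun setT X -> measurable_fun setT f -> (forall x, (0 <= f x)%R) ->
  (forall B : set R, measurable B -> \int[P]_w (W w * \1_B (X w))%:E = c%:E * P (X @^-1` B)) ->
  \int[P]_w (W w * f (X w))%:E = c%:E * \int[P]_w (f (X w))%:E.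
Proof.
move=> mW W0 c0 mX mf f0 indB.
have mfE : measurable_fun setT (EFin \o f) by exact/measurable_EFinP.
pose f_ := nnsfun_approx measurableT mfE.
have mf_X n : measurable_fun setT (f_ n \o X) by exact: measurableT_comp.
have mfX : measurable_fun setT (f \o X) by exact: measurableT_comp.
have f_f w : (f_ ^~ (X w)) n @[n --> \oo] --> f (X w).
  have h : EFin \o (f_ ^~ (X w)) @ \oo --> (f (X w))%:E.
    by apply: cvg_nnsfun_approx => //= x _; rewrite lee_fin.
  exact: fine_cvg h.
have mXB k n : measurable (X @^-1` (f_ n @^-1` [set k])).
  by rewrite -[_ @^-1` _]setTI; apply: mX => //; exact: measurable_funPTI.
have expand (V : T -> R) n : measurable_fun setT V -> (forall w, (0 <= V w)%R) ->
    \int[P]_w (V w * f_ n (X w))%:E =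
    \sum_(k \in range (f_ n)) (k%:E * \int[P]_w (V w * \1_(f_ n @^-1` [set k]) (X w))%:E).
  move=> mV V0.
  have mVk k : measurable_fun setT (fun w => (V w * \1_(f_ n @^-1` [set k]) (X w))%R).
    by apply: measurable_funM => //; apply: (measurable_indic (mXB k n)).
  transitivity (\int[P]_w \sum_(k \in range (f_ n)) (k * (V w * \1_(f_ n @^-1` [set k]) (X w)))%:E).
    apply: eq_integral => w _; rewrite fsumEFin //; congr EFin.
    rewrite [in LHS]fimfunE mulr_fsumr.
    by apply: eq_fsbigr => k _; rewrite mulrCA.
  rewrite ge0_integral_fsum //.
  - apply: eq_fsbigr => k; rewrite inE => -[x _ <-].
    under eq_integral do rewrite EFinM.
    rewrite ge0_integralZl //.
    + exact/measurable_EFinP.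
    + by move=> w _; rewrite lee_fin mulr_ge0.
    + by rewrite lee_fin.
  - by move=> k; apply/measurable_EFinP; apply: measurable_funM => //.
  - move=> k w _; rewrite lee_fin.
    have [k0|k0] := leP 0%R k; first by rewrite !mulr_ge0.
    by rewrite preimage_nnfun0 // indic0 !mulr0.
have step n : \int[P]_w (W w * f_ n (X w))%:E = \int[P]_w (c * f_ n (X w))%:E.
  rewrite !expand //; apply: eq_fsbigr => k _; congr (_ * _).
  have mB : measurable (f_ n @^-1` [set k]) by exact: measurable_funPTI.
  rewrite indB //; under [RHS]eq_integral do rewrite EFinM.
  rewrite ge0_integralZl //.
  - by congr (_ * _); have := integral_indic P measurableT (mXB k n); rewrite setIT => <-.
  - by apply/measurable_EFinP; apply: (measurable_indic (mXB k n)).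
rewrite -ge0_integralZl //; last 2 first.
- exact/measurable_EFinP.
- by move=> w _; rewrite lee_fin.
have mVf (V : T -> R) n : measurable_fun setT V ->
    measurable_fun setT (fun w => (V w * f_ n (X w))%:E).
  by move=> mV; apply/measurable_EFinP; apply: measurable_funM => //; exact: mf_X.
transitivity (limn (fun n => \int[P]_w (W w * f_ n (X w))%:E)).
  rewrite -monotone_convergence //.
  - apply: eq_integral => w _; apply/esym/cvg_lim => //.
    apply/cvg_EFin; first by near=> n.
    by apply: cvgM; [exact: cvg_cst | exact: f_f].
  - by move=> n; exact: mVf.
  - by move=> n w _; rewrite lee_fin mulr_ge0.
  - by move=> w _ m n mn; rewrite lee_fin ler_wpM2l //; exact/lefP/nd_nnsfun_approx.
under eq_fun do rewrite step.
rewrite -monotone_convergence //.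
- apply: eq_integral => w _; apply/cvg_lim => //; rewrite -EFinM.
  apply/cvg_EFin; first by near=> n.
  by apply: cvgM; [exact: cvg_cst | exact: f_f].
- by move=> n; exact: mVf.
- by move=> n w _; rewrite lee_fin mulr_ge0.
- by move=> w _ m n mn; rewrite lee_fin ler_wpM2l //; exact/lefP/nd_nnsfun_approx.
Unshelve. all: by end_near. Qed.

Variables (I : finType) (X : I -> {RV P >-> R}).
Hypothesis indep : mutually_independent X.

Let mX i : measurable_fun setT (X i). Proof. exact: measurable_funPT. Qed.

Let measurable_prodX (h : I -> R -> R) (Q : pred I) :
  (forall i, measurable_fun setT (h i)) ->
  measurable_fun setT (fun w => \prod_(i | Q i) h i (X i w))%R.
Proof.
move=> mh; under eq_fun do rewrite -big_filter.
by apply: measurable_prod => i _; apply: measurableT_comp => //; exact: mX.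
Qed.

(** The functions are replaced by indicators one at a time: the induction is on a
    list [s] outside of which every [h i] is an indicator.  When [s] is empty the
    claim is the product rule for events. *)
Lemma ge0_integral_prod_indep (h : I -> R -> R) (m : I -> R) :
  (forall i, measurable_fun setT (h i)) -> (forall i x, (0 <= h i x)%R) ->
  (forall i, \int[P]_w (h i (X i w))%:E = (m i)%:E) ->
  \int[P]_w (\prod_i h i (X i w))%:E = (\prod_i m i)%:E.
Proof.
move=> mh h0 hm.
have : forall i, i \notin enum I -> exists2 B : set R, measurable B & h i = \1_B.
  by move=> i; rewrite mem_enum.
elim: (enum I) h m mh h0 hm => [|i s IH] h m mh h0 hm hB.
  have /choice[B hBi] : forall i, exists B : set R, measurable B /\ h i = \1_B.
    by move=> i; have [//|B mB ->] := hB i; exists B.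
  have mXB i : measurable (X i @^-1` B i).
    by rewrite -[_ @^-1` _]setTI; apply: mX => //; exact: (hBi i).1.
  have hP i : (m i)%:E = P (X i @^-1` B i).
    rewrite -hm (hBi i).2; have := integral_indic P measurableT (mXB i).
    by rewrite setIT => <-.
  have -> : (\prod_i m i)%:E = \prod_(i in [set: I]%SET) P (X i @^-1` B i).
    rewrite (big_morph EFin EFinM (erefl 1)).
    by apply: eq_big => [i|i _]; rewrite ?inE // hP.
  rewrite -indep => [|i _]; last exact: (hBi i).1.
  set A := \bigcap_(i in _) _.
  have mA : measurable A by apply: fin_bigcap_measurable => // i _; exact: mXB.
  have := integral_indic P measurableT mA; rewrite setIT => <-.
  apply: eq_integral => w _; congr EFin; rewrite indicE.
  have [/set_mem wA|wA] := boolP (w \in A).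
    by rewrite big1 // => i _; rewrite (hBi i).2 indicE mem_set //; apply: wA; rewrite /= inE.
  apply/eqP; rewrite prodf_seq_eq0; apply/hasP.
  have [i hi] : exists i, ~ B i (X i w).
    by apply/existsNP => h'; move/negP: wA; apply; rewrite inE => i _; exact: h'.
  by exists i; rewrite ?mem_index_enum //= (hBi i).2 indicE memNset.
pose W w := (\prod_(j | j != i) h j (X j w))%R.
pose c := (\prod_(j | j != i) m j)%R.
have m0 j : (0 <= m j)%R.
  by rewrite -lee_fin -hm; apply: integral_ge0 => w _; rewrite lee_fin.
have -> : (\prod_j m j)%:E = c%:E * (m i)%:E by rewrite (bigD1 i) //= mulrC EFinM.
rewrite -hm -(@ge0_integral_mul_indep W) //.
- by apply: eq_integral => w _; rewrite (bigD1 i) //= mulrC.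
- exact: measurable_prodX.
- by move=> w; apply: prodr_ge0.
- by apply: prodr_ge0.
move=> B mB.
have mXB : measurable (X i @^-1` B) by rewrite -[_ @^-1` _]setTI; exact: mX.
have PB : P (X i @^-1` B) = (fine (P (X i @^-1` B)))%:E.
  by rewrite fineK //; exact: fin_num_measure.
pose h' j := if j == i then (\1_B : R -> R) else h j.
pose m' j := if j == i then fine (P (X i @^-1` B)) else m j.
rewrite PB -EFinM.
have -> : (c * fine (P (X i @^-1` B)) = \prod_j m' j)%R.
  rewrite [RHS](bigD1 i) //= {1}/m' eqxx mulrC; congr (_ * _)%R.
  by apply: eq_bigr => j /negPf ji; rewrite /m' ji.
rewrite -(IH h' m').
- apply: eq_integral => w _; rewrite [in RHS](bigD1 i) //= {1}/h' eqxx mulrC; congr (_ * _)%:E.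
  by apply: eq_bigr => j /negPf ji; rewrite /h' ji.
- by move=> j; rewrite /h'; case: eqP => // _; exact: measurable_indic.
- by move=> j x; rewrite /h'; case: eqP => // _.
- move=> j; rewrite /h' /m'; case: eqP => [->|_]; last exact: hm.
  by rewrite -PB; have := integral_indic P measurableT mXB; rewrite setIT => <-.
- move=> j js; rewrite /h'; case: (eqVneq j i) => [_|ji]; first by exists B.
  by apply: hB; rewrite inE negb_or ji.
Qed.

(** Positive and negative parts are separated in each factor, and the product is
    expanded over all choices of signs. *)
Lemma integral_prod_indep (f : I -> R -> R) (m : I -> R) :
  (forall i, measurable_fun setT (f i)) ->
  (forall i, P.-integrable setT (fun w => (f i (X i w))%:E)) ->
  (forall i, \int[P]_w (f i (X i w))%:E = (m i)%:E) ->
  P.-integrable setT (fun w => (\prod_i f i (X i w))%:E) /\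
  \int[P]_w (\prod_i f i (X i w))%:E = (\prod_i m i)%:E.
Proof.
move=> mf int_f fm.
pose h (b : bool) i x := (if b then Num.max (f i x) 0 else Num.max (- f i x) 0)%R.
have mh b i : measurable_fun setT (h b i).
  by case: b; apply: measurable_maxr => //; exact: measurable_funN.
have h0 b i x : (0 <= h b i x)%R by case: b; rewrite /h le_max lexx orbT.
have fh i x : f i x = (h true i x - h false i x)%R.
  rewrite /h; move: (f i x) => y.
  by have [y0|y0] := lerP y 0%R; have [y1|y1] := lerP (- y)%R 0%R; lra.
have h_le b i x : (h b i x <= `|f i x|)%R.
  by rewrite /h; case: b; rewrite ge_max normr_ge0 andbT ?ler_norm // -normrN ler_norm.
have mhX b i : measurable_fun setT (fun w => (h b i (X i w))%:E).
  by apply/measurable_EFinP; apply: measurableT_comp => //; exact: mX.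
have int_h b i : P.-integrable setT (fun w => (h b i (X i w))%:E).
  apply: le_integrable (int_f i) => // w _ /=.
  by rewrite lee_fin ger0_norm.
pose k b i := fine (\int[P]_w (h b i (X i w))%:E).
have hk b i : \int[P]_w (h b i (X i w))%:E = (k b i)%:E.
  by rewrite fineK //; exact: integrable_fin_num.
have mE i : m i = (k true i - k false i)%R.
  apply: EFin_inj; rewrite -fm EFinB -!hk -integralB //.
  by apply: eq_integral => w _; rewrite fh EFinB.
pose sg (e : {ffun I -> bool}) : R := (\prod_i (if e i then 1 else -1))%R.
have expand (z : bool -> I -> R) : (\prod_i (z true i - z false i) =
    \sum_(e : {ffun I -> bool}) sg e * \prod_i z (e i) i)%R.
  rewrite (eq_bigr (fun i => \sum_(b : bool) (if b then 1 else -1) * z b i)%R); last first.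
    by move=> i _; rewrite big_bool /= mul1r mulN1r.
  rewrite bigA_distr_bigA /=; apply: eq_bigr => e _.
  by rewrite -big_split.
have prodE w : (\prod_i f i (X i w))%:E =
    \sum_(e : {ffun I -> bool}) ((sg e)%:E * (\prod_i h (e i) i (X i w))%:E).
  rewrite (eq_bigr (fun i => h true i (X i w) - h false i (X i w))%R) => [|i _]; last exact: fh.
  rewrite (expand (fun b i => h b i (X i w))) -sumEFin.
  by apply: eq_bigr => e _; rewrite EFinM.
have int_e (e : {ffun I -> bool}) :
    \int[P]_w (\prod_i h (e i) i (X i w))%:E = (\prod_i k (e i) i)%:E.
  by apply: (ge0_integral_prod_indep (h := fun i => h (e i) i)).
have int_he (e : {ffun I -> bool}) :
    P.-integrable setT (fun w => (\prod_i h (e i) i (X i w))%:E).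
  apply/integrableP; split.
    by apply/measurable_EFinP; apply: (measurable_prodX (h := fun i => h (e i) i)).
  rewrite (eq_integral (fun w => (\prod_i h (e i) i (X i w))%:E)) ?int_e ?ltry //.
  by move=> w _; rewrite gee0_abs // lee_fin; apply: prodr_ge0.
have int_se (e : {ffun I -> bool}) :
    P.-integrable setT (fun w => (sg e)%:E * (\prod_i h (e i) i (X i w))%:E).
  exact: integrableZl.
split.
  by under eq_fun do rewrite prodE; exact: integrable_sum.
under eq_integral do rewrite prodE.
rewrite integral_sum //.
rewrite (eq_bigr (fun e : {ffun I -> bool} => (sg e * \prod_i k (e i) i)%:E)) => [|e _]; last first.
  by rewrite EFinM -int_e -integralZl.
rewrite sumEFin -expand; congr EFin; apply: eq_bigr => i _.
by rewrite mE.
Qed.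

End IndependentProducts.

(** * Moments of the entries and of the trace *)

Section EntryMoments.
Local Open Scope ereal_scope.
Context d (T : measurableType d) (R : realType) (P : probability T R).

Lemma same_distribution_integral (X Y : T -> R) (f : R -> R) :
  measurable_fun setT X -> measurable_fun setT Y -> measurable_fun setT f ->
  same_distribution P X Y ->
  \int[P]_w (f (X w))%:E = \int[P]_w (f (Y w))%:E.
Proof.
move=> mX mY mf XY.
have ge0 (g : R -> \bar R) : measurable_fun setT g -> (forall x, 0 <= g x) ->
    \int[P]_w g (X w) = \int[P]_w g (Y w).
  move=> mg g0.
  have h Z (mZ : measurable_fun setT Z) : \int[P]_w g (Z w) = \int[pushforward P Z]_x g x.
    by rewrite ge0_integral_pushforward.
  rewrite (h _ mX) (h _ mY).
  pose mfX : {mfun T >-> R} := HB.pack X (isMeasurableFun.Build _ _ _ _ _ mX).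
  pose mfY : {mfun T >-> R} := HB.pack Y (isMeasurableFun.Build _ _ _ _ _ mY).
  rewrite -[pushforward P X]/(distribution P (mfX : {RV P >-> R})).
  rewrite -[pushforward P Y]/(distribution P (mfY : {RV P >-> R})).
  by apply: eq_measure_integral => A mA _; exact: XY.
have mE : measurable_fun setT (EFin \o f) by exact/measurable_EFinP.
rewrite integralE [RHS]integralE; congr (_ - _).
  transitivity (\int[P]_w (EFin \o f)^\+ (X w)); first by
    apply: eq_integral => w _; rewrite !funeposE.
  rewrite ge0 //; last exact: measurable_funepos.
  by apply: eq_integral => w _; rewrite !funeposE.
transitivity (\int[P]_w (EFin \o f)^\- (X w)); first by
  apply: eq_integral => w _; rewrite !funenegE.
rewrite ge0 //; last exact: measurable_funeneg.
by apply: eq_integral => w _; rewrite !funenegE.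
Qed.

(** [|y| <= 1 + y^2] for [y = x^k]. *)
Lemma integrable_pow (X : T -> R) k : measurable_fun setT X ->
  \int[P]_w (X w ^+ (2 * k))%:E < +oo -> P.-integrable setT (fun w => (X w ^+ k)%:E).
Proof.
move=> mX fin.
have even x : (0 <= x ^+ (2 * k) :> R)%R by rewrite exprM; apply: exprn_ge0; exact: sqr_ge0.
have int2k : P.-integrable setT (fun w => (X w ^+ (2 * k))%:E).
  apply/integrableP; split; first by apply/measurable_EFinP; exact: measurable_funX.
  by under eq_integral do rewrite gee0_abs ?lee_fin //.
have int1 : P.-integrable setT (cst 1%:E).
  by apply: finite_measure_integrable_cst.
apply: le_integrable (integrableD measurableT int1 int2k) => //.
  by apply/measurable_EFinP; exact: measurable_funX.
move=> w _ /=; rewrite lee_fin [leRHS]ger0_norm ?addr_ge0 //.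
rewrite mulnC exprM; move: (X w ^+ k)%R => y.
have := sqr_ge0 (`|y| - 1)%R; have := normr_ge0 y.
by have := real_normK (num_real y); lra.
Qed.

End EntryMoments.

Section MatrixMoments.
Local Open Scope ereal_scope.
Context d (T : measurableType d) (R : realType) (P : probability T R).
Variables (n N : nat) (X : 'I_n -> 'I_N -> {RV P >-> R}) (i0 : 'I_n) (j0 : 'I_N).
Hypothesis X_iid : iid_entries X.
Hypothesis X_fin : forall k, \int[P]_w (X i0 j0 w ^+ (2 * k))%:E < +oo.

Definition entry_moment k : R := fine (\int[P]_w (X i0 j0 w ^+ k)%:E).

Let mX i j : measurable_fun setT (X i j). Proof. exact: measurable_funPT. Qed.

Let int_X i j k : P.-integrable setT (fun w => (X i j w ^+ k)%:E).
Proof.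
apply: integrable_pow => //.
rewrite (same_distribution_integral (f := fun x => (x ^+ (2 * k))%R) (Y := X i0 j0)) //.
exact: X_iid.2.
Qed.

Lemma entry_momentE i j k : \int[P]_w (X i j w ^+ k)%:E = (entry_moment k)%:E.
Proof.
rewrite /entry_moment fineK; last by apply: integrable_fin_num; last exact: int_X.
rewrite (same_distribution_integral (f := fun x => (x ^+ k)%R) (Y := X i0 j0)) //.
exact: X_iid.2.
Qed.

Lemma expectation_trace p : (0 < N)%N ->
  'E_P[fun w => (\tr (sample_covariance X w ^+ p.+1))%R] =
  (walk_sum p.+1 entry_moment n N / N%:R ^+ p.+1)%:E.
Proof.
move=> N0; rewrite unlock.
pose t (uv : {ffun 'I_p.+1 -> 'I_n} * {ffun 'I_p.+1 -> 'I_N}) w : R :=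
  (\prod_(e : 'I_n * 'I_N) X e.1 e.2 w ^+ edge_count uv.1 uv.2 e)%R.
have trE w : (\tr (sample_covariance X w ^+ p.+1) = (N%:R ^+ p.+1)^-1 * \sum_uv t uv w)%R.
  rewrite /sample_covariance; set G := _ *m _.
  have -> : ((N%:R^-1 *: G) ^+ p.+1 = (N%:R^-1) ^+ p.+1 *: G ^+ p.+1)%R.
    elim: (p.+1) => [|q IH]; first by rewrite !expr0 scale1r.
    by rewrite !exprS IH -[(_ * _)%R]/(_ *m _) -scalemxAl -scalemxAr scalerA.
  rewrite mxtraceZ exprVn; congr (_ * _)%R.
  rewrite gram_trace_walks pair_big; apply: eq_bigr => -[u v] _.
  by apply: eq_bigr => e _; rewrite mxE.
have prod_t (uv : {ffun 'I_p.+1 -> 'I_n} * {ffun 'I_p.+1 -> 'I_N}) := integral_prod_indep X_iid.1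
  (f := fun e x => (x ^+ edge_count uv.1 uv.2 e)%R)
  (m := fun e => entry_moment (edge_count uv.1 uv.2 e))
  (fun e => @measurable_funX _ _ _ _ _ _ (@measurable_id _ _ _))
  (fun e => int_X e.1 e.2 _) (fun e => entry_momentE e.1 e.2 _).
under eq_integral do rewrite trE EFinM -sumEFin.
rewrite (integralZl measurableT) //; last first.
  by apply: (integrable_sum measurableT) => uv _; exact: (prod_t uv).1.
rewrite (integral_sum measurableT) //; last by move=> uv; exact: (prod_t uv).1.
rewrite (eq_bigr (fun uv => (walk_weight entry_moment uv.1 uv.2)%:E)); last first.
  by move=> uv _; exact: (prod_t uv).2.
by rewrite sumEFin -EFinM mulrC /walk_sum pair_big.
Qed.

Lemma entry_moment0 : entry_moment 0 = 1%R.
Proof.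
apply: EFin_inj; rewrite -(entry_momentE i0 j0).
transitivity (\int[P]_w cst 1%:E w); first by apply: eq_integral => w _; rewrite expr0.
by rewrite integral_cst //= probability_setT mule1.
Qed.

Lemma entry_moment_even_ge0 k : (0 <= entry_moment (2 * k))%R.
Proof.
rewrite -lee_fin -(entry_momentE i0 j0); apply: integral_ge0 => w _.
by rewrite lee_fin exprM; apply: exprn_ge0; exact: sqr_ge0.
Qed.

Hypothesis X_sym : same_distribution P (X i0 j0) (\- X i0 j0)%R.

Lemma entry_moment_odd k : odd k -> entry_moment k = 0%R.
Proof.
move=> ok.
have : \int[P]_w (X i0 j0 w ^+ k)%:E = (-1)%:E * \int[P]_w (X i0 j0 w ^+ k)%:E.
  rewrite -integralZl //.
  rewrite (same_distribution_integral (f := fun x => (x ^+ k)%R) (Y := (\- X i0 j0)%R)) //.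
  by apply: eq_integral => w _ /=; rewrite -EFinM exprNn -signr_odd ok expr1.
by rewrite (entry_momentE i0 j0) -EFinM => -[]; lra.
Qed.

Lemma entry_moment_ge0 k : (0 <= entry_moment k)%R.
Proof.
have [ok|ek] := boolP (odd k); first by rewrite entry_moment_odd.
by rewrite -(even_halfK ek) -mul2n entry_moment_even_ge0.
Qed.

Hypothesis X_var1 : entry_moment 2 = 1%R.

(** Integrate Bernoulli's inequality [y^k >= 1 + k (y - 1)] for [y = x^2], whose
    expectation is 1. *)
Lemma entry_moment_ge1 k : (1 <= entry_moment (2 * k))%R.
Proof.
have bern (y : R) : (0 <= y)%R -> (1 + k%:R * (y - 1) <= y ^+ k)%R.
  move=> y0; elim: k => [|j IH]; first by rewrite mul0r addr0 expr0.
  rewrite exprS -natr1; have := ler_wpM2l y0 IH.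
  have : (0 <= j%:R * (y - 1) ^+ 2)%R by rewrite mulr_ge0 ?sqr_ge0.
  by rewrite expr2; lra.
have int1 : P.-integrable setT (cst 1%:E) by exact: finite_measure_integrable_cst.
have int2 := int_X i0 j0 2.
have : \int[P]_w (1 + k%:R%:E * ((X i0 j0 w ^+ 2)%:E - 1)) <= \int[P]_w (X i0 j0 w ^+ (2 * k))%:E.
  apply: le_integral => //; last first.
  - move=> w _; rewrite -EFinB -EFinM -EFinD lee_fin exprM.
    by apply: bern; exact: sqr_ge0.
  - by apply: (integrableD measurableT int1); apply: integrableZl => //; exact: integrableB.
rewrite integralD //; last by apply: integrableZl => //; exact: integrableB.
rewrite integralZl //; last exact: integrableB.
rewrite integralB // !(entry_momentE i0 j0) X_var1.
have -> : \int[P]_w cst 1%:E w = 1 by rewrite integral_cst //= probability_setT mule1.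
by rewrite subee // mule0 adde0 lee_fin.
Qed.

End MatrixMoments.

Section SubgaussianMoments.
Variable R : realType.

Lemma bin_le_pow2 n k : ('C(n, k) <= 2 ^ n)%N.
Proof.
elim: n k => [|n IH] [|k]; rewrite ?bin0 ?expn_gt0 //.
by rewrite binS expnS mul2n -addnn leq_add.
Qed.

Lemma pow_le_factorial k : (k ^ k <= 4 ^ k * k`!)%N.
Proof.
apply: (@leq_trans ((2 * k) ^_ k)).
  rewrite ffact_prod -[X in (_ ^ X <= _)%N]card_ord -prod_nat_const.
  by apply: leq_prod => i _; have := ltn_ord i; lia.
by rewrite -bin_ffact leq_mul2r -[4%N]/(2 ^ 2)%N -expnM bin_le_pow2 orbT.
Qed.

Lemma factorial_le_gauss k : (k`! <= gauss_moment (2 * k))%N.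
Proof.
elim: k => [//|k IH]; rewrite mulnS factS [gauss_moment _]/=; apply: leq_mul => //.
by lia.
Qed.

(** [k^k <= 4^k k!] turns the subgaussian bound into [(4C)^k (2k-1)!!].  Only
    [k - 1] powers of [K] are available: this suffices for [k >= 2] with [K] at least
    [(4C)^2], and for [k = 1] because of the normalisation [mu 2 = 1]. *)
Lemma subgaussian_le_gauss (C : R) : 0 < C -> exists2 K : nat, (0 < K)%N &
  forall mu : nat -> R, mu 2 = 1 ->
  (forall k, (0 < k)%N -> mu (2 * k)%N <= (C * k%:R) ^+ k) ->
  forall m, mu (2 * m.+1)%N <= K%:R ^+ m * gauss_mu R (2 * m.+1).
Proof.
move=> C0; pose K := (Num.bound ((4 * C) ^+ 2)).+1.
have K1 : 1 <= K%:R :> R by rewrite ler1n.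
have KC : (4 * C) ^+ 2 <= K%:R.
  apply: ltW; apply: lt_le_trans (archi_boundP (sqr_ge0 _)) _.
  by rewrite ler_nat.
exists K => // mu mu2 mu_le [|m]; first by rewrite muln1 mu2 expr0 mul1r.
apply: le_trans (mu_le m.+2 _) _ => //.
have h1 : (m.+2%:R ^+ m.+2 : R) <= 4 ^+ m.+2 * gauss_mu R (2 * m.+2).
  rewrite -!natrX -natrM ler_nat; apply: leq_trans (pow_le_factorial _) _.
  by rewrite leq_mul2l factorial_le_gauss orbT.
rewrite exprMn; apply: le_trans (ler_wpM2l (exprn_ge0 _ (ltW C0)) h1) _.
rewrite mulrA -exprMn [C * 4]mulrC; apply: ler_wpM2r; first exact: gauss_mu_ge0.
have C40 : 0 <= 4 * C by rewrite mulr_ge0 // ltW.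
have [C1|C1] := leP (4 * C) 1.
  by apply: (@le_trans _ _ 1); [exact: exprn_ile1 | exact: exprn_ege1].
apply: (@le_trans _ _ ((4 * C) ^+ (2 * m.+1))).
  by apply: ler_weXn2l; [exact: ltW | lia].
by rewrite exprM; apply: lerXn2r; rewrite ?nnegrE ?exprn_ge0.
Qed.

End SubgaussianMoments.

(** * The asymptotic estimate *)

Section RelativeError.
Variable R : realType.

Lemma bernoulli_onem (x : R) k : 0 <= x <= 1 -> 1 - k%:R * x <= (1 - x) ^+ k.
Proof.
move=> /andP[x0 x1]; elim: k => [|k IH]; first by rewrite mul0r subr0 expr0.
rewrite exprS; have x1' : 0 <= 1 - x by rewrite subr_ge0.
apply: le_trans (ler_wpM2l x1' IH); rewrite -natr1.
have : 0 <= k%:R * x ^+ 2 by rewrite mulr_ge0 ?sqr_ge0.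
by rewrite expr2; lra.
Qed.

Lemma pow_onep_le (x : R) k : 0 <= x <= 1 -> k%:R * x <= 2^-1 ->
  (1 + x) ^+ k <= 1 + 2 * (k%:R * x).
Proof.
move=> x01 kx; have b := bernoulli_onem k x01; move/andP: x01 => [x0 x1].
set y := k%:R * x in kx b *; have y0 : 0 <= y by rewrite mulr_ge0.
have y1 : 0 < 1 - y by lra.
have p0 : 0 <= (1 + x) ^+ k by rewrite exprn_ge0 // addr_ge0.
have h1 : (1 + x) ^+ k * (1 - y) <= 1.
  apply: le_trans (ler_wpM2l p0 b) _; rewrite -exprMn.
  have -> : (1 + x) * (1 - x) = 1 - x ^+ 2 by ring.
  apply: exprn_ile1; last by rewrite lerBlDr lerDl sqr_ge0.
  by rewrite subr_ge0 exprn_ile1.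
rewrite -(ler_pM2r y1); apply: le_trans h1 _; nra.
Qed.

(** Both bounds are of the form [(1 + O(q/m))^(O(q))]; the condition on [m] makes the
    total error small enough to be linearised. *)
Lemma walk_sum_relative_error p (mu : nat -> R) (K n N m : nat) :
  mu 0%N = 1 -> (forall k, 0 <= mu k) -> (forall k, odd k -> mu k = 0) ->
  (forall k, 1 <= mu (2 * k)%N) -> (0 < K)%N ->
  (forall j, mu (2 * j.+1)%N <= K%:R ^+ j * gauss_mu R (2 * j.+1)) ->
  (m <= n)%N -> (m <= N)%N -> (12 * K * p.+1 ^ 2 <= m)%N ->
  `|walk_sum p.+1 mu n N / mp_profile n%:R N%:R p.+1 - 1| <= (12 * K * p.+1 ^ 2)%:R / m%:R.
Proof.
move=> mu0 mu_ge0 mu_odd mu_ge1 K0 mu_le mn mN Kqm.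
set q := p.+1 in Kqm *.
have qq : (q <= q ^ 2)%N by rewrite -mulnn leq_pmulr.
have Kq : (q ^ 2 <= K * q ^ 2)%N by rewrite leq_pmull.
have q0 : (0 < q ^ 2)%N by [].
have [m0 qm Kn] : [/\ (0 < m)%N, (q <= m)%N & (K * q ^ 2 <= n)%N].
  by move: Kqm; rewrite -mulnA; move: qq Kq q0 mn; split; lia.
have mR : 0 < m%:R :> R by rewrite ltr0n.
have prof : 0 < mp_profile n%:R N%:R q :> R.
  by apply: mp_profile_gt0; rewrite ltr0n (leq_trans m0).
set b : R := (12 * K * q ^ 2)%:R / m%:R.
have up := walk_sum_le mu0 mu_ge0 mu_odd K0 m0 mn mN Kn (fun j _ => mu_le j).
have lo := walk_sum_ge mu0 mu_ge0 m0 qm mn mN (fun j _ => mu_ge1 j.+1).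
rewrite ler_norml; apply/andP; split.
  rewrite lerBrDr ler_pdivlMr // mulrC; apply: le_trans lo.
  apply: ler_wpM2l; first exact: ltW.
  have x01 : 0 <= (q%:R / m%:R : R) <= 1.
    by rewrite divr_ge0 ?ler0n //= ler_pdivrMr // mul1r ler_nat.
  apply: le_trans (bernoulli_onem (2 * q) x01).
  rewrite addrC lerD2l lerN2 mulrA -natrM /b ler_pM2r ?invr_gt0 // ler_nat.
  by rewrite !expnS expn0; nia.
rewrite lerBlDr ler_pdivrMr // mulrC; apply: le_trans up _.
apply: ler_wpM2l; first exact: ltW.
set x : R := (2 * K * q)%:R / m%:R.
have kx : (2 * q).+1%:R * x <= b / 2.
  rewrite /x /b mulrA -natrM mulrAC; apply: ler_wpM2r; first by rewrite invr_ge0 ltW.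
  rewrite ler_pdivlMr // -natrM ler_nat !expnS expn0; nia.
have b1 : b <= 1 by rewrite /b ler_pdivrMr // mul1r ler_nat.
have x0 : 0 <= x by rewrite divr_ge0 ?ler0n.
have x1 : x <= 1.
  apply: le_trans b1; rewrite /x /b ler_pM2r ?invr_gt0 // ler_nat.
  by rewrite !expnS expn0; nia.
apply: le_trans (pow_onep_le _ _) _; rewrite ?x0 ?x1 //.
  by apply: le_trans kx _; lra.
rewrite addrC lerD2r; move: kx; move: (_%:R * x) => y ky.
clearbody b; lra.
Qed.

End RelativeError.

(** The estimate for fixed dimensions; [m] is to be the smaller of the two. *)
Lemma trace_moment_estimate (R : realType) d (T : measurableType d) (P : probability T R)
    (n N p K : nat) (C : R) (X : 'I_n -> 'I_N -> {RV P >-> R}) :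
  (0 < n)%N -> (0 < N)%N -> (0 < K)%N ->
  (forall mu : nat -> R, mu 2 = 1 ->
    (forall k, (0 < k)%N -> mu (2 * k)%N <= (C * k%:R) ^+ k) ->
    forall j, mu (2 * j.+1)%N <= K%:R ^+ j * gauss_mu R (2 * j.+1)) ->
  iid_entries X ->
  (forall i j, same_distribution P (X i j) (\- X i j)) ->
  (forall i j k, (0 < k)%N ->
    ('E_P[fun w => (X i j w ^+ (2 * k))%R] <= (((C * k%:R) ^+ k)%R)%:E)%E) ->
  (forall i j, ('E_P[fun w => (X i j w ^+ 2)%R] = 1)%E) ->
  exists w : R, ('E_P[fun w => (\tr (sample_covariance X w ^+ p.+1))%R] = w%:E)%E /\
    forall m, (m <= n)%N -> (m <= N)%N -> (12 * K * p.+1 ^ 2 <= m)%N ->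
    `|w / (n%:R * mp_moment p.+1 (n%:R / N%:R)) - 1| <= (12 * K * p.+1 ^ 2)%:R / m%:R.
Proof.
move=> n0 N0 K0 KP X_iid X_sym X_sub X_var.
have [i0 j0] : 'I_n * 'I_N by split; [exact: Ordinal n0 | exact: Ordinal N0].
have X_fin k : (\int[P]_w (X i0 j0 w ^+ (2 * k))%:E < +oo)%E.
  case: k => [|k]; last first.
    by have := X_sub i0 j0 k.+1 isT; rewrite unlock => /le_lt_trans; apply; rewrite ltry.
  rewrite muln0 (eq_integral (cst 1%E)); last by move=> w _; rewrite expr0.
  by rewrite integral_cst //= probability_setT mule1 ltry.
have muE := entry_momentE X_iid X_fin.
have mu2 : entry_moment X i0 j0 2 = 1.
  by apply: EFin_inj; rewrite -(muE i0 j0); have := X_var i0 j0; rewrite unlock.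
have mu_sub k : (0 < k)%N -> entry_moment X i0 j0 (2 * k) <= (C * k%:R) ^+ k.
  by move=> k0; rewrite -lee_fin -(muE i0 j0); have := X_sub i0 j0 k k0; rewrite unlock.
exists (walk_sum p.+1 (entry_moment X i0 j0) n N / N%:R ^+ p.+1).
split; first exact: expectation_trace.
move=> m mn mN Km.
have NR : N%:R ^+ p.+1 != 0 :> R by rewrite expf_neq0 // pnatr_eq0 -lt0n.
have -> : n%:R * mp_moment p.+1 (n%:R / N%:R) = mp_profile n%:R N%:R p.+1 / N%:R ^+ p.+1 :> R.
  by rewrite /mp_profile /= mulrAC mulfK.
rewrite invf_div mulrA divfK //.
apply: walk_sum_relative_error => //.
- exact: entry_moment0.
- exact: entry_moment_ge0.
- by move=> k; exact: entry_moment_odd.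
- by move=> k; exact: entry_moment_ge1.
- exact: KP.
Qed.

Theorem theorem4 (R : realType)
    (N : nat -> nat) (gamma : R)
    (N_gt0 : forall n, (0 < N n)%N)
    (gamma_gt0 : 0 < gamma)
    (ratio_cvg : n%:R / (N n)%:R @[n --> \oo] --> gamma)
    (d : nat -> measure_display) (T : forall n, measurableType (d n))
    (P : forall n, probability (T n) R)
    (X : forall n, 'I_n -> 'I_(N n) -> {RV (P n) >-> R})
    (X_iid : forall n, iid_entries (X n))
    (X_sym : forall n i j, same_distribution (P n) (X n i j) (\- X n i j))
    (C : R) (C_gt0 : 0 < C)
    (X_subgaussian : forall n i j k, (0 < k)%N ->
      ('E_(P n)[fun w => (X n i j w ^+ (2 * k))%R] <= (((C * k%:R) ^+ k)%R)%:E)%E)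
    (X_var1 : forall n i j, ('E_(P n)[fun w => (X n i j w ^+ 2)%R] = 1)%E)
    (p : nat -> nat)
    (p_gt0 : forall n, (0 < p n)%N)
    (p_small : (fun n => (p n)%:R : R) =o_\oo (fun n => Num.sqrt n%:R : R)) :
  exists e : nat -> R,
    e =O_\oo (fun n => (p n)%:R ^+ 2 / n%:R : R) /\
    \forall n \near \oo,
      ('E_(P n)[fun w => (\tr (sample_covariance (X n) w ^+ p n))%R] =
       (n%:R * mp_moment (p n) (n%:R / (N n)%:R) * (1 + e n))%R%:E)%E.
Proof.
have [K K0 KP] := subgaussian_le_gauss C_gt0.
have KR : 0 < (12 * K)%:R :> R by rewrite ltr0n muln_gt0.
pose E n := 'E_(P n)[fun w => (\tr (sample_covariance (X n) w ^+ p n))%R]%E.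
pose main n : R := n%:R * mp_moment (p n) (n%:R / (N n)%:R).
have main_gt0 n : (0 < n)%N -> 0 < main n.
  move=> n0; rewrite mulr_gt0 ?ltr0n //.
  have := @mp_seq_gt0 R n%:R (N n)%:R _ _ (p n); rewrite /mp_seq !ltr0n.
  by case: (p n) (p_gt0 n) => // q _; apply.
pose e n := fine (E n) / main n - 1.
(* eventually c * n <= min(n, N n), since N n is at least n / (2 gamma) *)
pose c := Num.min 1 (2 * gamma)^-1.
have c0 : 0 < c by rewrite lt_min ltr01 invr_gt0 mulr_gt0.
have near_p : \forall n \near \oo, (12 * K)%:R * (p n)%:R ^+ 2 <= c * n%:R :> R.
  have eps0 : 0 < Num.sqrt (c / (12 * K)%:R) by rewrite sqrtr_gt0 divr_gt0.
  have /eqoP/(_ _ eps0) := p_small; apply: filterS => n.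
  rewrite !ger0_norm ?sqrtr_ge0 ?ler0n // => h.
  have := lerXn2r 2 _ _ h; rewrite !nnegrE ler0n mulr_ge0 ?sqrtr_ge0 // => /(_ isT isT).
  rewrite exprMn !sqr_sqrtr ?ler0n ?divr_ge0 ?(ltW c0) ?(ltW KR) // => h2.
  apply: le_trans (ler_wpM2l (ltW KR) h2) _.
  by rewrite mulrA mulrCA divff ?gt_eqF // mulr1.
have near_N : \forall n \near \oo, n%:R / (N n)%:R <= 2 * gamma :> R.
  by apply: cvgr_le ratio_cvg _ _; lra.
have estimate n : (0 < n)%N -> n%:R / (N n)%:R <= 2 * gamma :> R ->
    (12 * K)%:R * (p n)%:R ^+ 2 <= c * n%:R :> R ->
    E n \is a fin_num /\ `|e n| <= (12 * K)%:R / c * ((p n)%:R ^+ 2 / n%:R).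
  move=> n0 nN pn; have nR : 0 < n%:R :> R by rewrite ltr0n.
  have NR : 0 < (N n)%:R :> R by rewrite ltr0n.
  have [q pq] : exists q, p n = q.+1 by exists (p n).-1; rewrite prednK.
  have [w []] := trace_moment_estimate q n0 (N_gt0 n) K0 KP (X_iid n)
    (X_sym n) (X_subgaussian n) (X_var1 n).
  rewrite -pq -/(E n) => Ew west; rewrite /e Ew; split => //=.
  pose m := minn n (N n).
  have mc : c * n%:R <= m%:R :> R.
    rewrite /m /minn; case: ltnP => _.
      by rewrite -[leRHS]mul1r ler_wpM2r ?ler0n // ge_min lexx.
    apply: (@le_trans _ _ ((2 * gamma)^-1 * n%:R)).
      by rewrite ler_wpM2r ?ler0n // ge_min lexx orbT.
    by rewrite mulrC ler_pdivrMr ?mulr_gt0 // mulrC -ler_pdivrMr.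
  have Km : (12 * K * p n ^ 2 <= m)%N.
    by rewrite -(ler_nat R) natrM natrX; apply: le_trans mc.
  apply: le_trans (west m (geq_minl _ _) (geq_minr _ _) Km) _.
  have cn : 0 < c * n%:R by exact: mulr_gt0.
  have -> : (12 * K)%:R / c * ((p n)%:R ^+ 2 / n%:R) = (12 * K * p n ^ 2)%:R / (c * n%:R) :> R.
    by rewrite [in RHS]natrM natrX mulf_div.
  by apply: ler_wpM2l; rewrite ?ler0n // lef_pV2 // posrE (lt_le_trans cn).
have near_n : \forall n \near \oo, (0 < n)%N by exact: nbhs_infty_gt.
have near_e : \forall n \near \oo, [/\ (0 < n)%N, E n \is a fin_num &
    `|e n| <= (12 * K)%:R / c * ((p n)%:R ^+ 2 / n%:R)].
  near=> n; have n0 : (0 < n)%N by near: n.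
  by have [] := estimate n n0 (near near_N n _) (near near_p n _).
exists e; split.
  apply/eqO_exP; exists ((12 * K)%:R / c); first exact: divr_gt0.
  apply: filterS near_e => n [_ _ le_e].
  by rewrite [`|_ / _|]ger0_norm // divr_ge0 ?sqr_ge0.
apply: filterS near_e => n [n0 Efin _].
rewrite -/(E n) -/(main n) /e addrC subrK mulrC divfK ?gt_eqF ?main_gt0 //.
by rewrite fineK.
Unshelve. all: by end_near.
Qed.
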